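(* Let $X=(X_1,\ldots,X_n)$ be a vector of independent $\mathcal{X}$-valued random variables, let $f:\mathcal{X}^n\to\mathbb{R}$ be measurable, and let $W:=f(X)$. Suppose that $\mathbb{E}W=0$ and $\mathbb{E}W^2=1$. Let $Z$ be a standard normal random variable, and let $\Delta_i f$ and $T$ be defined as in the context. Then \[ \sup_{t\in\mathbb{R}}|\mathbb{P}(W\le t)-\mathbb{P}(Z\le t)|\le 2\biggl(\sqrt{\mathrm{Var}(\mathbb{E}(T|W))}+\frac14\sum_{i=1}^n\mathbb{E}|\Delta_i f|^3\biggr)^{1/2}. \]
   Context: $\mathcal{X}$ is a measurable space. Let $X'=(X'_1,\ldots,X'_n)$ be an independent copy of $X$, and $[n]=\{1,\ldots,n\}$. For each $A\subseteq[n]$ define the random vector $X^A$ by $X^A_i=X'_i$ if $i\in A$ and $X^A_i=X_i$ if $i\notin A$. Write $X^i$ for $X^{\{i\}}$ and $A\cup i$ for $A\cup\{i\}$. Define \[ \Delta_i f:=f(X)-f(X^i), \] and for $A\subseteq[n]$ and $i\notin A$, \[ \Delta_i f^A:=f(X^A)-f(X^{A\cup i}). \] For each proper subset $A$ of $[n]$ define \[ \nu(A):=\frac{1}{n\binom{n-1}{|A|}}, \] and define \[ T:=\frac12\sum_{i=1}^n\sum_{A\subseteq[n]\setminus\{i\}}\nu(A)\,\Delta_i f\,\Delta_i f^A . \] The quantities $\mathrm{Var}(\mathbb{E}(T|W))$ and $\mathbb{E}|\Delta_i f|^3$ are regarded as elements of $[0,\infty]$; the bound is trivial if one of them is infinite.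 *)

(* Defs.v *)
From HB Require Import structures.
From mathcomp Require Import all_boot all_order all_algebra.
From mathcomp Require Import all_classical all_reals all_analysis.
From mathcomp Require Import measurable_realfun.

Set Implicit Arguments.
Unset Strict Implicit.
Unset Printing Implicit Defensive.

Import Order.TTheory GRing.Theory Num.Theory.
Import numFieldNormedType.Exports.

Local Open Scope classical_set_scope.
Local Open Scope ring_scope.

Section independence.
Context (d : measure_display) (Omega : measurableType d) (R : realType)
        (P : probability Omega R).

Definition indep2 (d1 d2 : measure_display) (E1 : measurableType d1)
    (E2 : measurableType d2) (X : Omega -> E1) (Y : Omega -> E2) : Prop :=
  forall (A : set E1) (B : set E2), measurable A -> measurable B ->
    P (X @^-1` A `&` Y @^-1` B) = (P (X @^-1` A) * P (Y @^-1` B))%E.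

Definition mutual_indep (I : finType) (d1 : measure_display)
    (E : measurableType d1) (X : I -> Omega -> E) : Prop :=
  forall (J : {set I}) (B : I -> set E), (forall i, measurable (B i)) ->
    P (\bigcap_(i in [set` J]) X i @^-1` B i) =
    (\prod_(i in J) P (X i @^-1` B i))%E.

(* A measure is a function on all subsets whose values outside the
   sigma-algebra are irrelevant, hence the restriction to measurable sets. *)
Definition same_law (d1 : measure_display) (E : measurableType d1)
    (X Y : {RV P >-> E}) : Prop :=
  forall A : set E, measurable A -> distribution P X A = distribution P Y A.

Definition independent_copy (d1 : measure_display) (E : measurableType d1)
    (X X' : {RV P >-> E}) : Prop :=
  indep2 X X' /\ same_law X X'.

Definition standard_normal (Z : {RV P >-> R}) : Prop :=
  forall A : set R, measurable A -> distribution P Z A = normal_prob 0 1 A.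

(* [Y] is a version of E(V | W): it is measurable for the sigma-algebra
   generated by [W], whose elements are the sets [W @^-1` B]. *)
Definition is_cond_exp (d1 : measure_display) (E : measurableType d1)
    (V : Omega -> R) (W : Omega -> E) (Y : Omega -> R) : Prop :=
  [/\ measurable_fun [set: g_sigma_algebra_preimageType W] Y,
      P.-integrable [set: Omega] (EFin \o Y) &
      forall B : set E, measurable B ->
        (\int[P]_(w in W @^-1` B) (Y w)%:E =
         \int[P]_(w in W @^-1` B) (V w)%:E)%E].

(* Radon-Nikodym: integrable variables do have conditional expectations. *)
Lemma is_cond_exp_exists (d1 : measure_display) (E : measurableType d1)
    (V : Omega -> R) (W : {mfun Omega >-> E}) :
  P.-integrable [set: Omega] (EFin \o V) ->
  exists Y : Omega -> R, is_cond_exp V W Y.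
Proof.
move=> intV.
have mV := measurable_int P intV.
have mW : measurable_fun [set: Omega] W by [].
pose nuV : {charge set E -> \bar R} :=
  measure_function_pushforward__canonical__charge_Charge
    (charge_induced_charge__canonical__charge_Charge intV) mW.
have dom : nuV `<< distribution P W.
  apply: dominates_pushforward => //.
  apply/null_content_dominatesP => A mA PA.
  by apply: null_set_integral => //; apply: measurable_funS mV.
pose h := Radon_Nikodym nuV (distribution P W).
have hE : EFin \o (fine \o h \o W) = h \o W.
  by apply/funext => w /=; rewrite fineK// Radon_Nikodym_fin_num.
have inth : (distribution P W).-integrable [set: E] h.
  exact: Radon_Nikodym_integrable.
have mh := measurable_int (distribution P W) inth.
have ih : P.-integrable [set: Omega] (h \o W).
  apply/integrableP; split; first exact: measurableT_comp.
  have /integrableP[_] := inth.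
  by rewrite ge0_integral_pushforward//; exact: measurableT_comp.
exists (fine \o h \o W); split.
- move=> _ B mB; rewrite setTI.
  exists ((fine \o h) @^-1` B); last by rewrite setTI.
  rewrite -[X in measurable X]setTI.
  by apply: measurableT_comp mB => //.
- by rewrite hE.
- move=> B mB.
  transitivity (\int[P]_(w in W @^-1` B) (h \o W) w)%E.
    by apply: eq_integral => w _; rewrite -[RHS](congr1 (@^~ w) hE).
  rewrite -integral_pushforward//.
    by rewrite -[LHS](Radon_Nikodym_integral dom mB).
  by apply: integrableS ih => //; exact: measurable_funPTI.
Qed.

End independence.

Section swapping.
Context (R : realType) (E : Type) (n : nat).
Implicit Types (f : n.-tuple E -> R) (A : {set 'I_n}).

Definition swap (x x' : n.-tuple E) A : n.-tuple E :=
  [tuple if i \in A then tnth x' i else tnth x i | i < n].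

Definition Delta f (x x' : n.-tuple E) (i : 'I_n) : R := f x - f (swap x x' [set i]).

Definition DeltaA f (x x' : n.-tuple E) (i : 'I_n) A : R :=
  f (swap x x' A) - f (swap x x' (i |: A)).

Definition nu A : R := (n%:R * 'C(n.-1, #|A|)%:R)^-1.

Definition Tstat f (x x' : n.-tuple E) : R :=
  2^-1 * \sum_(i < n) \sum_(A : {set 'I_n} | A \subset [set~ i])
    nu A * Delta f x x' i * DeltaA f x x' i A.

End swapping.

(* Main.v *)
Require Import Defs.
From HB Require Import structures.
From mathcomp Require Import all_boot all_order all_algebra.
From mathcomp Require Import all_classical all_reals all_analysis.
From mathcomp Require Import measurable_realfun.
From mathcomp Require Import ring lra.

Set Implicit Arguments.
Unset Strict Implicit.
Unset Printing Implicit Defensive.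

Import Order.TTheory GRing.Theory Num.Theory.
Import numFieldNormedType.Exports.

Local Open Scope classical_set_scope.
Local Open Scope ring_scope.

(** The proof is Stein's method with smoothed indicators.

Fix t and 0 < eps <= 3/5, and let h be the continuous function equal to 1 on
]-oo, t], to 0 on [t + eps, +oo[ and affine in between. Let c be the mean of
h(Z). Stein's equation phi'(x) - x phi(x) = h(x) - c has a bounded solution
phi with |phi'| <= 2/eps and phi' Lipschitz of constant 2/eps
([stein_solution]). Hence E h(W) - c = E phi'(W) - E (W phi(W)).

The second term is computed from the exchangeability of X_i and X'_i. Along a
uniformly random ordering of the indices, f(X) - f(X') telescopes into the
increments Delta_i f^A, each with weight nu(A) ([averaged_path_sum]). As
f(X') is centered and independent of X, E (phi(W) W) is the weighted sum of
the E (phi(W) Delta_i f^A). Exchanging X_i and X'_i turns phi(f(X)) into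
phi(f(X^i)) and changes the sign of Delta_i f^A, so
E (phi(W) W) = 1/2 sum_i sum_A nu(A) E ((phi(W) - phi(f(X^i))) Delta_i f^A)
([stein_covariance_identity]). Replacing phi(W) - phi(f(X^i)) by
phi'(W) Delta_i f gives E (phi'(W) T), up to an error of at most
(2/eps) (1/4) sum_i E |Delta_i f|^3 ([stein_remainder]): the Taylor remainder
is at most (1/eps) |Delta_i f|^2, the weights nu(A) sum to 1 for each i, and
|Delta_i f^A| has the law of |Delta_i f|.

With phi the identity, the same formula gives E T = E W^2 = 1. So, with Y a
version of E(T|W), E phi'(W) - E (phi'(W) T) = E (phi'(W) (1 - Y)) is at most
(2/eps) sqrt (Var Y). Let q be the quantity under the square root in the
theorem. Then |E h(W) - c| <= (2/eps) q ([hinge_mean_distance]). The mean of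
h(Z) differs from P(Z <= t), and from P(Z <= t + eps), by at most eps/4, because
the normal density is at most 1/2; so the distance between the two distribution
functions is at most (2/eps) q + eps/4 ([cdf_distance]). There is nothing to
prove if q >= 1/4; otherwise eps = (6/5) sqrt q is allowed and gives
(59/30) sqrt q <= 2 sqrt q ([smoothing_optimum]). *)

(** * Solutions of u' = x u + k *)

Section gaussian_ode.
Context {R : realType}.
Implicit Types (u k f df : R -> R).

Lemma is_derive_ndecr f df (a b : R) : a <= b ->
  (forall x, a <= x <= b -> is_derive x 1 f (df x)) ->
  (forall x, a <= x <= b -> 0 <= df x) -> f a <= f b.
Proof.
move=> ab fD df0.
have [||c cab E] := @MVT_segment R f df a b ab.
- move=> x; rewrite in_itv/= => /andP[ax xb]; apply: fD; lra.
- apply: derivable_within_continuous => x; rewrite in_itv/= => xab.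
  by have [] := fD x xab.
rewrite -subr_ge0 E mulr_ge0 ?subr_ge0//; exact: df0.
Qed.

Definition gexp (x : R) := expR (- (x ^+ 2 / 2)).

Lemma gexp_gt0 (x : R) : 0 < gexp x.
Proof. exact: expR_gt0. Qed.

#[local] Hint Resolve gexp_gt0 : core.

Lemma gexp_ge0 (x : R) : 0 <= gexp x.
Proof. exact: ltW. Qed.
#[local] Hint Resolve gexp_ge0 : core.

Lemma gexpN (x : R) : gexp (- x) = gexp x.
Proof. by rewrite /gexp sqrrN. Qed.

Lemma gexp_le1 (x : R) : gexp x <= 1.
Proof. by rewrite /gexp -expR0 ler_expR oppr_le0 divr_ge0// sqr_ge0. Qed.

Lemma gexp_lb (x : R) : 1 - x ^+ 2 / 2 <= gexp x.
Proof. exact: (expR_ge1Dx (- (x ^+ 2 / 2))). Qed.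

Lemma gexp1_ub : gexp 1 <= 2 / 3.
Proof.
have E : gexp 1 * expR (2^-1) = 1.
  by rewrite /gexp expr1n div1r -expRD addNr expR0.
have := expR_ge1Dx (2^-1 : R); have := gexp_gt0 1; nra.
Qed.

#[local] Instance is_derive_gexp (x : R) : is_derive x 1 gexp (- x * gexp x).
Proof.
rewrite /gexp; apply: is_derive_eq.
by rewrite /GRing.scale/=; field.
Qed.

(** The condition that singles out one solution of [u' = x u + k]: two solutions
differ by a multiple of [exp (x ^ 2 / 2)]. *)
Definition gauss_negligible u := forall eta : R, 0 < eta ->
  exists a : R, forall w, a <= `|w| -> `|u w| * gexp w <= eta.

Lemma gauss_negligibleN u : gauss_negligible u -> gauss_negligible (fun x => - u x).
Proof.
by move=> ut e e0; have [a ha] := ut _ e0; exists a => w /ha; rewrite normrN.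
Qed.

Lemma gauss_negligible_opp u :
  gauss_negligible u -> gauss_negligible (fun x => u (- x)).
Proof.
move=> ut e e0; have [a ha] := ut _ e0; exists a => w; rewrite -normrN => /ha.
by rewrite gexpN.
Qed.

(** With [e x := exp (- x ^ 2 / 2)], the derivative of [u * e] is [k * e >= - M * e],
and that of [M / x * e] is below [- M * e]. So [M / x * e - u * e] decreases on
the half-line, and it tends to 0 at infinity. *)
Lemma stein_ode_pos u k (M w : R) :
  (forall x : R, is_derive x 1 u (x * u x + k x)) -> (forall x, - M <= k x) ->
  0 <= M -> gauss_negligible u -> 0 < w -> w * u w <= M.
Proof.
move=> uD kM M0 ut w0.
pose V x := M * x^-1 * gexp x - u x * gexp x.
have dV (x : R) : x != 0 -> is_derive x 1 (fun x => V x)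
    (- (M * (1 + x ^- 2) + k x) * gexp x).
  move=> x0; rewrite /V.
  have dx : is_derive x 1 (fun x : R => x^-1) (- x ^- 2).
    apply: is_derive_eq; first exact: is_deriveV.
    by rewrite /GRing.scale/= mulr1.
  have du := uD x.
  apply: is_derive_eq.
  by rewrite /GRing.scale/=; field.
have Vdecr y : w <= y -> V y <= V w.
  move=> wy; rewrite -lerN2.
  apply: (@is_derive_ndecr (fun x => - V x)
    (fun x => (M * (1 + x ^- 2) + k x) * gexp x)) => // x /andP[wx _].
    have x0 : x != 0 by rewrite gt_eqF// (lt_le_trans w0).
    have := dV x x0 => dVx.
    by apply: is_derive_eq; rewrite mulNr opprK.
  rewrite mulr_ge0//.
  have : 0 <= M * x ^- 2 by rewrite mulr_ge0// invr_ge0 sqr_ge0.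
  by rewrite mulrDr mulr1; have := kM x; lra.
have Vw : 0 <= V w.
  apply/ler_addgt0Pr => e e0.
  have [a ha] := ut _ e0.
  pose y := Num.max w a.
  have yw : w <= y by rewrite le_max lexx.
  have y0 : 0 < y := lt_le_trans w0 yw.
  have ya : a <= `|y| by rewrite gtr0_norm// le_max lexx orbT.
  have := ha _ ya; have := Vdecr _ yw.
  have : 0 <= M * y^-1 * gexp y.
    by rewrite !mulr_ge0 ?invr_ge0 ?gexp_ge0// ltW.
  have : u y * gexp y <= `|u y| * gexp y by rewrite ler_wpM2r// ler_norm.
  rewrite [V y]/V; lra.
have := gexp_gt0 w; move: Vw; rewrite /V -mulrBl => + g0.
rewrite pmulr_lge0// subr_ge0 mulrC => h.
have : w * u w <= w * (w^-1 * M) by rewrite ler_pM2l.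
by rewrite mulrA divff ?mul1r// gt_eqF.
Qed.

(** The equation is stable under [u, k |-> - u, - k], and under the reflection
[x |-> - x] up to the sign of [k], so that all four sign cases reduce to the
one-sided bound. *)
Lemma stein_ode_mul u k (M : R) :
  (forall x : R, is_derive x 1 u (x * u x + k x)) -> (forall x, `|k x| <= M) ->
  gauss_negligible u -> forall w, `|w * u w| <= M.
Proof.
move=> uD kM ut.
have M0 : 0 <= M := le_trans (normr_ge0 _) (kM 0).
have kM1 x : - M <= k x by have := kM x; rewrite ler_norml => /andP[].
have kM2 x : - M <= - k x by rewrite lerN2; apply: le_trans (ler_norm _) (kM x).
have uN (x : R) : is_derive x 1 (fun y => - u y) (x * - u x + (- k x)).
  by have := uD x => dux; apply: is_derive_eq; rewrite opprD mulrN.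
have pos (w : R) : 0 < w -> `|w * u w| <= M.
  move=> w0; rewrite ler_norml; apply/andP; split.
    rewrite lerNl -mulrN.
    exact: (stein_ode_pos uN kM2 M0 (gauss_negligibleN ut)).
  exact: (stein_ode_pos uD kM1).
have uR (x : R) : is_derive x 1 (fun y => u (- y)) (x * u (- x) + (- k (- x))).
  have := uD (- x) => dux; apply: is_derive_eq; rewrite /GRing.scale/=; ring.
have uRN (x : R) : is_derive x 1 (fun y => - u (- y)) (x * - u (- x) + k (- x)).
  have := uR x => dux; apply: is_derive_eq; rewrite /GRing.scale/=; ring.
move=> w; have [w0|w0|->] := ltgtP w 0; [|exact: pos|by rewrite mul0r normr0].
rewrite -oppr_gt0 in w0.
have utR := gauss_negligible_opp ut.
rewrite ler_norml; apply/andP; split.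
  rewrite -[w]opprK mulNr lerN2.
  by apply: (stein_ode_pos uR) => // x; exact: kM2.
rewrite -mulrNN -[in u w](opprK w).
apply: (stein_ode_pos uRN (fun x => kM1 (- x)) M0) => //.
exact: gauss_negligibleN.
Qed.

(** For [1 <= |w|] the bound on [w u(w)] suffices. On [0, 1] the function
[u * gexp + M x] is nondecreasing, so [u w] is controlled by [u 1 <= M]; the
constant is [1 + 2 / 3], where [2 / 3] bounds [exp (- 1 / 2)]. *)
Lemma stein_ode_sup u k (M : R) :
  (forall x : R, is_derive x 1 u (x * u x + k x)) -> (forall x, `|k x| <= M) ->
  gauss_negligible u -> forall w, `|u w| <= 5 / 3 * M.
Proof.
move=> uD kM ut.
have M0 : 0 <= M := le_trans (normr_ge0 _) (kM 0).
have main v l w : (forall x : R, is_derive x 1 v (x * v x + l x)) ->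
    (forall x, `|l x| <= M) -> gauss_negligible v -> 0 <= w -> v w <= 5 / 3 * M.
  move=> vD lM vt w0.
  have vmul := stein_ode_mul vD lM vt.
  have [w1|w1] := leP 1 w.
    have := vmul w; rewrite ler_norml => /andP[_ h]; nra.
  have : v w * gexp w + M * w <= v 1 * gexp 1 + M * 1.
    apply: (@is_derive_ndecr (fun x => v x * gexp x + M * x)
      (fun x => l x * gexp x + M)); first exact: ltW.
      move=> x _; have := vD x => dvx.
      by apply: is_derive_eq; rewrite /GRing.scale/=; ring.
    move=> x _; have := lM x; rewrite ler_norml => /andP[h _].
    have := gexp_le1 x; have := gexp_gt0 x; nra.
  have : v 1 <= M.
    by have := vmul 1; rewrite mul1r ler_norml => /andP[].
  have := gexp1_ub; have := gexp_gt0 1; have := gexp_lb w; have := gexp_gt0 w.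
  move=> g0 glb g10 g1 v1 h.
  rewrite -(ler_pM2r g0).
  have : v 1 * gexp 1 <= 2 / 3 * M by nra.
  have : 5 / 3 * M * (1 - w ^+ 2 / 2) <= 5 / 3 * M * gexp w.
    by apply: ler_wpM2l => //; lra.
  have : 0 <= M * w * (1 - w) by rewrite !mulr_ge0// subr_ge0 ltW.
  have : 0 <= M * w by rewrite mulr_ge0.
  rewrite expr2; nra.
have uN (x : R) : is_derive x 1 (fun y => - u y) (x * - u x + (- k x)).
  by have := uD x => dux; apply: is_derive_eq; rewrite opprD mulrN.
have uR (x : R) : is_derive x 1 (fun y => u (- y)) (x * u (- x) + (- k (- x))).
  have := uD (- x) => dux; apply: is_derive_eq; rewrite /GRing.scale/=; ring.
have uRN (x : R) : is_derive x 1 (fun y => - u (- y)) (x * - u (- x) + k (- x)).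
  have := uR x => dux; apply: is_derive_eq; rewrite /GRing.scale/=; ring.
have kN x : `|- k x| <= M by rewrite normrN.
have utR := gauss_negligible_opp ut.
move=> w; rewrite ler_norml lerNl; have [w0|w0] := leP 0 w.
  by rewrite (main _ _ _ uD) // (main _ _ _ uN) //; exact: gauss_negligibleN.
have {}w0 : 0 <= - w by lra.
have := main _ _ _ uR (fun x => kN (- x)) utR w0.
have := main _ _ _ uRN (fun x => kM (- x)) (gauss_negligibleN utR) w0.
by rewrite opprK => -> ->.
Qed.

Lemma bounded_gauss_negligible (u : R -> R) (M : R) :
  (forall x, `|u x| <= M) -> gauss_negligible u.
Proof.
move=> uM eta eta0.
have M0 : 0 <= M := le_trans (normr_ge0 _) (uM 0).
exists (1 + 2 * (M / eta)) => w hw.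
have q0 : 0 <= M / eta by rewrite divr_ge0// ltW.
apply: (@le_trans _ _ (M * gexp w)); first by rewrite ler_wpM2r ?gexp_ge0.
have E : gexp w * expR (w ^+ 2 / 2) = 1 by rewrite /gexp -expRD addNr expR0.
have e1 := expR_ge1Dx (w ^+ 2 / 2).
have g0 := gexp_gt0 w.
have w2 : M / eta <= w ^+ 2 / 2.
  rewrite -(real_normK (num_real w)) expr2; nra.
have : gexp w * (M / eta) <= 1 by nra.
move=> h1.
have -> : M * gexp w = gexp w * (M / eta) * eta by field; rewrite gt_eqF.
by rewrite ler_piMl// ltW.
Qed.

End gaussian_ode.

(** * The Stein equation of a nonincreasing Lipschitz function *)

Section stein_solution.
Context {R : realType}.
Notation mu := (@lebesgue_measure R).
Notation p := (@normal_pdf R 0 1).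
Implicit Types (h : R -> R) (w x : R).

Lemma normal_pdf01E x : p x = normal_peak 1 * gexp x.
Proof.
rewrite normal_pdfE ?oner_eq0// /normal_fun /gexp subr0 expr1n.
by congr (_ * expR _); rewrite mulNr.
Qed.

Lemma normal_peak1_le : @normal_peak R 1 <= 2^-1.
Proof.
rewrite /normal_peak expr1n mul1r lef_pV2 ?posrE//; last first.
  by rewrite sqrtr_gt0 mulrn_wgt0// pi_gt0.
have {1}-> : 2 = Num.sqrt (2 ^+ 2) :> R by rewrite sqrtr_sqr ger0_norm.
rewrite ler_sqrt; last by apply: mulrn_wge0; exact: pi_ge0.
have := @pi_ge2 R; rewrite -mulr_natr; lra.
Qed.

Lemma normal_pdf01_gt0 x : 0 < p x.
Proof. by rewrite normal_pdf01E mulr_gt0 ?normal_peak_gt0 ?oner_eq0// gexp_gt0. Qed.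

Lemma integrable_mul_normal_pdf h (M : R) (D : set R) : measurable D ->
  measurable_fun setT h -> (forall x, `|h x| <= M) ->
  mu.-integrable D (EFin \o (fun x => h x * p x)).
Proof.
move=> mD mh hM.
have M0 : 0 <= M := le_trans (normr_ge0 _) (hM 0).
suff : mu.-integrable [set: R] (EFin \o (fun x => h x * p x)) by exact: integrableS.
apply: (@le_integrable _ _ _ mu setT measurableT _ (fun x => (M * p x)%:E)).
- by apply/measurable_EFinP/measurable_funM => //; exact: measurable_normal_pdf.
- move=> x _ /=; rewrite lee_fin !normrM ler_wpM2r//.
  by rewrite (ger0_norm M0).
- under eq_fun do rewrite EFinM.
  by apply: integrableZl => //; exact: integrable_normal_pdf.
Qed.

Lemma normal_primitive_derive h (M : R) w : continuous h -> (forall x, `|h x| <= M) ->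
  is_derive w 1 (fun y => \int[mu]_(x in `]-oo, y]) (h x * p x)) (h w * p w).
Proof.
move=> ch hM.
have [| | | |dH H'] := @continuous_FTC1 R (fun x => h x * p x) -oo%O w (w + 1).
- by rewrite ltrDl.
- apply: (@integrable_mul_normal_pdf _ M) => //.
  exact: continuous_measurable_fun.
- by rewrite ltNyr.
- apply: cvgM; last exact: continuous_normal_pdf (oner_neq0 _) _.
  exact: ch.
by rewrite -H' derive1E; exact/derivableP.
Qed.

Definition normal_mean h := \int[mu]_x (h x * p x).

(** Both tails are read off the distribution function of the identity, seen as a
random variable under the normal law. *)
Lemma normal_tails (eta : R) : 0 < eta -> exists a : R,
  (forall w, w <= - a -> \int[mu]_(x in `]-oo, w]) p x <= eta) /\
  (forall w, a <= w -> \int[mu]_(x in `]w, +oo[) p x <= eta).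
Proof.
move=> eta0.
have mid : @measurable_fun _ _ (measurableTypeR R) R setT idfun.
  by move=> mT B mB; rewrite preimage_id; exact: measurableI.
pose Id : {RV (@normal_prob R 0 1) >-> R} :=
  @mfun_Sub _ _ (measurableTypeR R) R idfun (mem_set mid).
have /fine_cvgP[_ /cvgrPdist_le /(_ _ eta0)[a1 [_ ha1]]] := @cvg_cdfNy0 _ _ _ _ Id.
have /fine_cvgP[_ /cvgrPdist_le /(_ _ eta0)[a2 [_ ha2]]] := @cvg_ccdfy0 _ _ _ _ Id.
exists (Num.max (- a1) a2 + 1); split=> w.
  move=> wa; have /ha1 : w < a1.
    have : - a1 <= Num.max (- a1) a2 by rewrite le_max lexx.
    lra.
  by rewrite /= sub0r normrN ger0_norm ?fine_ge0//.
move=> wa; have /ha2 : a2 < w.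
  have : a2 <= Num.max (- a1) a2 by rewrite le_max lexx orbT.
  lra.
by rewrite /= sub0r normrN ger0_norm ?fine_ge0//.
Qed.

Section solution.
Variable h : R -> R.
Hypothesis ch : continuous h.
Hypothesis h01 : forall x, 0 <= h x <= 1.

Let mh : measurable_fun setT h.
Proof. exact: continuous_measurable_fun. Qed.

Let c := normal_mean h.

Lemma Rintegral_normal_pdf01 : \int[mu]_x p x = 1.
Proof. by rewrite /Rintegral integral_normal_pdf. Qed.

Lemma normal_mean01 : 0 <= c <= 1.
Proof.
apply/andP; split.
  apply: Rintegral_ge0 => x _; rewrite mulr_ge0 ?normal_pdf_ge0//.
  by have /andP[] := h01 x.
rewrite -Rintegral_normal_pdf01; apply: le_Rintegral => //.
- apply: (@integrable_mul_normal_pdf _ 1) => // x.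
  by have := h01 x; rewrite ler_norml => /andP[? ->]; rewrite andbT; lra.
- exact: integrable_normal_pdf.
- move=> x _; rewrite ler_piMl ?normal_pdf_ge0//.
  by have /andP[] := h01 x.
Qed.

Lemma norm_center_le1 x : `|h x - c| <= 1.
Proof.
by have := normal_mean01; have := h01 x; rewrite ler_norml; move=> *; lra.
Qed.

(** Divided by the normal density, this is the bounded solution of the Stein
equation of [h]. *)
Definition stein_primitive w := \int[mu]_(x in `]-oo, w]) ((h x - c) * p x).

Lemma integrable_center (D : set R) : measurable D ->
  mu.-integrable D (EFin \o (fun x => (h x - c) * p x)).
Proof.
move=> mD; apply: (@integrable_mul_normal_pdf _ 1) => //.
  exact: measurable_funB.
exact: norm_center_le1.
Qed.

Lemma norm_center_int (D : set R) : measurable D ->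
  `|\int[mu]_(x in D) ((h x - c) * p x)| <= \int[mu]_(x in D) p x.
Proof.
move=> mD; apply: le_trans; first by apply: le_normr_Rintegral => //; exact: integrable_center.
apply: le_Rintegral => //.
- have : mu.-integrable D (EFin \o (fun x => `|h x - c| * p x)).
    apply: (@integrable_mul_normal_pdf _ 1) => //.
      by apply: measurableT_comp => //; exact: measurable_funB.
    by move=> x; rewrite normr_id norm_center_le1.
  congr (integrable _ _ _); apply/funext => x /=.
  by rewrite normrM (ger0_norm (normal_pdf_ge0 _ _ _)).
- apply: (@integrableS _ _ _ mu [set: R]) => //; exact: integrable_normal_pdf.
- move=> x _; rewrite normrM (ger0_norm (normal_pdf_ge0 _ _ _)).
  by rewrite ler_piMl ?normal_pdf_ge0// norm_center_le1.
Qed.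

(** [(h - c) * p] has integral 0, so integrating from either end agrees; each
expression gives the decay at its own end. *)
Lemma stein_primitive_right w : stein_primitive w = - \int[mu]_(x in `]w, +oo[) ((h x - c) * p x).
Proof.
rewrite -(@Rintegral_itvB R (fun x => (h x - c) * p x) -oo%O +oo%O)//=; last first.
  by rewrite set_itvE; exact: integrable_center.
have -> : \int[mu]_(t in [set` `]-oo, +oo[]) ((h t - c) * p t) = 0.
  rewrite set_itvE; under eq_Rintegral do rewrite mulrBl.
  rewrite RintegralB//.
  - by rewrite RintegralZl ?Rintegral_normal_pdf01 ?mulr1 ?subrr//; exact: integrable_normal_pdf.
  - apply: (@integrable_mul_normal_pdf _ 1) => // x.
    by have := h01 x; rewrite ler_norml => /andP[? ->]; rewrite andbT; lra.
  - by apply: (@integrable_mul_normal_pdf (cst c) `|c|).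
by rewrite sub0r opprK.
Qed.

Lemma stein_primitive_derive w : is_derive w 1 stein_primitive ((h w - c) * p w).
Proof.
apply: (@normal_primitive_derive (fun x => h x - c) 1) => [x|x].
  by apply: cvgB; [exact: ch|exact: cvg_cst].
exact: norm_center_le1.
Qed.

Hypothesis h_nincr : forall x y, x <= y -> h y <= h x.

Let stein_primitive_tail (eta : R) : 0 < eta ->
  exists a : R, forall w, a <= `|w| -> `|stein_primitive w| <= eta.
Proof.
move=> eta0; have [a [aN ay]] := normal_tails eta0.
exists a => w; have [w0|w0] := leP 0 w.
  rewrite (ger0_norm w0) => aw; rewrite stein_primitive_right normrN.
  by apply: le_trans (ay _ aw); exact: norm_center_int.
rewrite (ltr0_norm w0) => aw.
apply: le_trans (aN w _); last by rewrite lerNr.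
exact: norm_center_int.
Qed.

(** [h] is nonincreasing, so [h - c] changes sign once, from nonnegative to
nonpositive: the primitive increases from its limit 0 at -oo, then decreases to
its limit 0 at +oo. *)
Lemma stein_primitive_ge0 w : 0 <= stein_primitive w.
Proof.
apply/ler_addgt0Pr => e e0; have [a ha] := stein_primitive_tail e0.
have [g0|g0] := leP c (h w).
  pose y := Num.min w (- `|a|).
  have : stein_primitive y <= stein_primitive w.
    apply: (is_derive_ndecr _ (fun x _ => stein_primitive_derive x)).
      by rewrite ge_min lexx.
    move=> x /andP[_ xw]; rewrite mulr_ge0 ?normal_pdf_ge0// subr_ge0.
    by rewrite (le_trans g0)// h_nincr.
  have ya : y <= - `|a| by rewrite ge_min lexx orbT.
  have : `|stein_primitive y| <= e.
    apply: ha; have := ler_norm a; have := ler_norm (- y); rewrite normrN; lra.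
  by rewrite ler_norml => /andP[]; lra.
pose y := Num.max w `|a|.
have : - stein_primitive w <= - stein_primitive y.
  apply: (@is_derive_ndecr _ (fun x => - stein_primitive x) (fun x => - ((h x - c) * p x))).
  - by rewrite le_max lexx.
  - by move=> x _; have Hx := stein_primitive_derive x; apply: is_derive_eq.
  - move=> x /andP[wx _]; rewrite -mulNr mulr_ge0 ?normal_pdf_ge0// opprB subr_ge0.
    by rewrite (le_trans _ (ltW g0))// h_nincr.
have ya : `|a| <= y by rewrite le_max lexx orbT.
have : `|stein_primitive y| <= e.
  apply: ha; have := ler_norm a; have := ler_norm y; lra.
by rewrite ler_norml => /andP[]; lra.
Qed.

Let phi w := stein_primitive w * (p w)^-1.
Let dphi w := w * phi w + (h w - c).

Let phi_derive w : is_derive w 1 phi (dphi w).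
Proof.
have pn0 : p w != 0 by rewrite gt_eqF// normal_pdf01_gt0.
have dp : is_derive w 1 p (- w * p w).
  rewrite (_ : p = fun x => normal_peak 1 * gexp x); last first.
    by apply/funext => x; exact: normal_pdf01E.
  have dg := is_derive_gexp w.
  by apply: is_derive_eq; rewrite /GRing.scale/=; ring.
have dpV : is_derive w 1 (fun x : R => (p x)^-1) (w * (p w)^-1).
  have dpV := is_deriveV pn0 dp; apply: is_derive_eq.
  by rewrite /GRing.scale/=; field.
have dH := stein_primitive_derive w.
apply: is_derive_eq; rewrite /dphi /phi /GRing.scale/=; field => //.
Qed.

Let phi_negligible : gauss_negligible phi.
Proof.
move=> eta eta0.
have peak0 : 0 < @normal_peak R 1 by rewrite normal_peak_gt0// oner_eq0.
have [a ha] := stein_primitive_tail (mulr_gt0 eta0 peak0).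
exists a => w /ha; rewrite /phi normal_pdf01E normrM.
rewrite (@ger0_norm _ (_^-1)); last by rewrite invr_ge0 mulr_ge0 ?gexp_ge0 ?ltW.
rewrite invfM -!mulrA mulVf ?mulr1 ?gt_eqF ?gexp_gt0//.
by rewrite ler_pdivrMr.
Qed.

Let phi_ge0 w : 0 <= phi w.
Proof. by rewrite /phi mulr_ge0 ?stein_primitive_ge0// invr_ge0 normal_pdf_ge0. Qed.

Let phi_sup w : `|phi w| <= 5 / 3.
Proof.
by have := stein_ode_sup phi_derive norm_center_le1 phi_negligible w; rewrite mulr1.
Qed.

(** The Lipschitz bound on [df] needs no second derivative: the increment
[f (x + d) - f x] solves the same differential equation, with right-hand side
[d * f (x + d) + (h (x + d) - h x)]. The first term lies in [0, 5 / 3 * d]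
because [f] is nonnegative, the second one in [- d / eps, 0] because [h] is
nonincreasing, so their sum is at most [d / eps] in absolute value. The
hypothesis on [eps] makes [1] and [5 / 3] smaller than [1 / eps]. *)
Lemma stein_solution (eps : R) : 0 < eps -> eps <= 3 / 5 ->
  (forall x d : R, 0 <= d -> h x - h (x + d) <= d / eps) ->
  exists f df : R -> R, [/\
    forall w : R, is_derive w 1 f (df w),
    forall w, df w = w * f w + (h w - normal_mean h),
    forall w, `|f w| <= 5 / 3,
    forall w, `|df w| <= 2 / eps &
    forall x y, `|df x - df y| <= 2 / eps * `|x - y| ].
Proof.
move=> eps0 eps1 hlip.
have ieps : 5 / 3 <= eps^-1.
  by rewrite -[leLHS]invrK lef_pV2 ?posrE ?invr_gt0//; lra.
exists phi, dphi; split => //.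
- move=> w; apply: le_trans (ler_normD _ _) _.
  have := stein_ode_mul phi_derive norm_center_le1 phi_negligible w.
  have := norm_center_le1 w; lra.
- suff L (x d : R) : 0 <= d -> `|dphi (x + d) - dphi x| <= 2 / eps * d.
    move=> x y; have [xy|yx] := leP x y.
      rewrite distrC (distrC x y) (ger0_norm (_ : 0 <= y - x)) ?subr_ge0//.
      by have := L x (y - x); rewrite subr_ge0 [x + _]addrC subrK; apply.
    rewrite (ger0_norm (_ : 0 <= x - y)); last by rewrite subr_ge0 ltW.
    by have := L y (x - y); rewrite subr_ge0 [y + _]addrC subrK; apply; exact: ltW.
  move=> d0.
  pose u y := phi (y + d) - phi y.
  pose k y := d * phi (y + d) + (h (y + d) - h y).
  have uD (y : R) : is_derive y 1 u (y * u y + k y).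
    have d1 : is_derive y 1 (fun z => phi (z + d)) (dphi (y + d)).
      have dd : is_derive y 1 (fun z : R => z + d) 1 by apply: is_derive_eq; rewrite addr0.
      have dp := phi_derive (y + d).
      by have := @is_derive1_comp R phi (fun z => z + d) y _ _ dp dd; rewrite mulr1.
    have d2 := phi_derive y.
    apply: is_derive_eq; rewrite /dphi /k /u; ring.
  have kM y : `|k y| <= d / eps.
    have := phi_sup (y + d); have := phi_ge0 (y + d).
    have := hlip y _ d0; have := @h_nincr y (y + d); rewrite lerDl => /(_ d0).
    move=> h1 h2 f0 /ler_normlP[_ f1].
    have : d * phi (y + d) <= d / eps by rewrite ler_wpM2l// (le_trans f1).
    have : 0 <= d * phi (y + d) by rewrite mulr_ge0.
    rewrite /k ler_norml => *; lra.
  have un : gauss_negligible u.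
    apply: (@bounded_gauss_negligible _ _ (10 / 3)) => y; apply: le_trans (ler_normB _ _) _.
    have := phi_sup (y + d); have := phi_sup y; lra.
  have um := stein_ode_mul uD kM un x.
  have -> : dphi (x + d) - dphi x = x * u x + k x by rewrite /dphi /k /u; ring.
  apply: le_trans (ler_normD _ _) _; have := kM x; lra.
Qed.

End solution.

End stein_solution.

(** * Smoothed indicators and a Taylor bound *)

Section smoothing.
Context {R : realType}.
Notation mu := (@lebesgue_measure R).
Notation p := (@normal_pdf R 0 1).

Definition hinge (t eps x : R) : R := Num.min 1 (Num.max 0 ((t + eps - x) / eps)).

Definition normal_cdf (w : R) := \int[mu]_(x in `]-oo, w]) p x.

Variables (t eps : R).
Hypothesis eps0 : 0 < eps.
Let h := hinge t eps.

Lemma hinge01 x : 0 <= h x <= 1.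
Proof. by rewrite /h /hinge le_min ge_min lexx ler01 le_max lexx. Qed.

Lemma hinge1 x : x <= t -> h x = 1.
Proof.
move=> xt; rewrite /h /hinge; apply/min_idPl; rewrite le_max; apply/orP; right.
by rewrite ler_pdivlMr// mul1r; lra.
Qed.

Lemma hinge0 x : t + eps <= x -> h x = 0.
Proof.
move=> xt; rewrite /h /hinge.
have -> : Num.max 0 ((t + eps - x) / eps) = 0.
  by apply/max_idPl; rewrite ler_pdivrMr// mul0r; lra.
by apply/min_idPr; exact: ler01.
Qed.

Lemma hinge_lin x : t <= x <= t + eps -> h x = (t + eps - x) / eps.
Proof.
move=> /andP[tx xt]; rewrite /h /hinge.
have -> : Num.max 0 ((t + eps - x) / eps) = (t + eps - x) / eps.
  by apply/max_idPr; rewrite ler_pdivlMr// mul0r; lra.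
by apply/min_idPr; rewrite ler_pdivrMr// mul1r; lra.
Qed.

Lemma hinge_nincr x y : x <= y -> h y <= h x.
Proof.
move=> xy; rewrite /h /hinge le_min ge_min lexx/= ge_min; apply/orP; right.
rewrite ge_max le_max lexx/= le_max; apply/orP; right.
by rewrite ler_pM2r ?invr_gt0//; lra.
Qed.

Lemma hinge_lip x d : 0 <= d -> h x - h (x + d) <= d / eps.
Proof.
move=> d0; have de : 0 <= d / eps by rewrite divr_ge0// ltW.
have E : (t + eps - (x + d)) / eps = (t + eps - x) / eps - d / eps.
  by rewrite -mulrBl; congr (_ / _); ring.
rewrite /h /hinge E.
move: ((t + eps - x) / eps) (d / eps) de => A D D0.
rewrite lerBlDr -lerBlDl le_min; apply/andP; split.
  have : Num.min 1 (Num.max 0 A) <= 1 by rewrite ge_min lexx.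
  lra.
have : Num.min 1 (Num.max 0 A) <= Num.max 0 A by rewrite ge_min lexx orbT.
have : 0 <= Num.max 0 (A - D) by rewrite le_max lexx.
have : A - D <= Num.max 0 (A - D) by rewrite le_max lexx orbT.
case: (leP A 0) => ? *; lra.
Qed.

Lemma continuous_hinge : continuous h.
Proof.
move=> x; apply: (@continuous_min R R (cst 1)
  (fun y => Num.max 0 ((t + eps - y) / eps)) x); first exact: cvg_cst.
apply: (@continuous_max R R (cst 0) (fun y => (t + eps - y) / eps) x); first exact: cvg_cst.
apply: cvgM; last exact: cvg_cst.
by apply: cvgB; [exact: cvg_cst|exact: cvg_id].
Qed.

Lemma norm_hinge x : `|h x| <= 1.
Proof. by have := hinge01 x; rewrite ler_norml => /andP[? ->]; rewrite andbT; lra. Qed.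

Lemma normal_cdf_derive (w : R) : is_derive w 1 normal_cdf (p w).
Proof.
have c1 : continuous (fun _ : R => 1 : R) by exact: cst_continuous.
have b1 (x : R) : `|1 : R| <= 1 by rewrite normr1.
have := normal_primitive_derive w c1 b1; rewrite mul1r.
suff -> : (fun y => \int[mu]_(x in `]-oo, y]) (1 * p x)) = normal_cdf by [].
by apply/funext => y; apply: eq_Rintegral => x _; rewrite mul1r.
Qed.

Let J w := \int[mu]_(x in `]-oo, w]) (h x * p x).

Let J_derive (w : R) : is_derive w 1 J (h w * p w).
Proof. by apply: (@normal_primitive_derive _ _ 1); [exact: continuous_hinge|exact: norm_hinge]. Qed.

Let J_t : J t = normal_cdf t.
Proof.
apply: eq_Rintegral => x; rewrite inE/= in_itv/= => xt.
by rewrite hinge1 ?mul1r.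
Qed.

Let J_mean : J (t + eps) = normal_mean h.
Proof.
have I : mu.-integrable [set` Interval -oo%O +oo%O] (EFin \o (fun x => h x * p x)).
  apply: (@integrable_mul_normal_pdf _ _ 1) => //; last exact: norm_hinge.
  exact: continuous_measurable_fun continuous_hinge.
have := @Rintegral_itvB R _ -oo%O +oo%O (t + eps) I isT isT.
rewrite [in X in X - _]set_itvE.
rewrite (_ : \int[mu]_(x in [set` `]t + eps, +oo[]) _ = 0); last first.
  transitivity (\int[mu]_(x in [set` `]t + eps, +oo[]) 0); last first.
    by rewrite Rintegral_cst ?mul0r.
  apply: eq_Rintegral => x; rewrite inE/= in_itv/= andbT => xt.
  by rewrite hinge0 ?mul0r ?ltW.
by move=> /subr0_eq E; exact: esym E.
Qed.

Let pdf_le x : p x <= 2^-1.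
Proof.
by apply: le_trans (normal_pdf_ub _ _ (oner_neq0 _)) _; exact: normal_peak1_le.
Qed.

(** The density is at most 1/2 and the hinge has mean 1/2 over [t, t + eps]. The
integral over that interval is bounded by comparing derivatives in its upper
endpoint. *)
Lemma normal_mean_hinge_le : normal_mean h <= normal_cdf t + eps / 4.
Proof.
rewrite -J_mean -J_t.
have te : t <= t + eps by rewrite lerDl ltW.
have : - (t + eps - t) ^+ 2 / (4 * eps) - J t <=
    - (t + eps - (t + eps)) ^+ 2 / (4 * eps) - J (t + eps).
  apply: (@is_derive_ndecr _ (fun x => - (t + eps - x) ^+ 2 / (4 * eps) - J x)
    (fun x => (t + eps - x) / (2 * eps) - h x * p x) _ _ te) => x tx.
    have dJ := J_derive x; apply: is_derive_eq; rewrite /GRing.scale/=; field.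
    by rewrite gt_eqF.
  rewrite hinge_lin// subr_ge0 [in leRHS]invfM mulrA.
  rewrite [leRHS]mulrAC ler_wpM2l//.
  by case/andP: tx => ? ?; apply: divr_ge0; [lra|exact: ltW].
have -> : - (t + eps - t) ^+ 2 / (4 * eps) = - (eps / 4).
  by field; rewrite gt_eqF.
rewrite subrr expr0n/= oppr0 mul0r; lra.
Qed.

Lemma normal_cdf_le_normal_mean_hinge : normal_cdf (t + eps) <= normal_mean h + eps / 4.
Proof.
rewrite -J_mean.
have te : t <= t + eps by rewrite lerDl ltW.
have : (t - t) ^+ 2 / (4 * eps) - (normal_cdf t - J t) <=
    (t + eps - t) ^+ 2 / (4 * eps) - (normal_cdf (t + eps) - J (t + eps)).
  apply: (@is_derive_ndecr _ (fun x => (x - t) ^+ 2 / (4 * eps) - (normal_cdf x - J x))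
    (fun x => (x - t) / (2 * eps) - (1 - h x) * p x) _ _ te) => x tx.
    have dJ := J_derive x; have dP := normal_cdf_derive x.
    apply: is_derive_eq; rewrite /GRing.scale/=; field.
    by rewrite gt_eqF.
  have -> : 1 - h x = (x - t) / eps.
    by rewrite hinge_lin//; field; rewrite gt_eqF.
  rewrite subr_ge0 [in leRHS]invfM mulrA.
  rewrite [leRHS]mulrAC ler_wpM2l//.
  by case/andP: tx => ? ?; apply: divr_ge0; [lra|exact: ltW].
have -> : (t + eps - t) ^+ 2 / (4 * eps) = eps / 4.
  by field; rewrite gt_eqF.
rewrite subrr expr0n/= mul0r J_t; lra.
Qed.

End smoothing.

Section taylor.
Context {R : realType}.

(** The mean value theorem would lose the factor 1/2. It is kept by showing that
[L / 2 * (z - x) ^ 2] minus or plus the remainder at [z] is monotone in [z] on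
either side of [x], where it vanishes. *)
Lemma taylor_lipschitz (f df : R -> R) (L x y : R) :
  (forall z : R, is_derive z 1 f (df z)) ->
  (forall a b, `|df a - df b| <= L * `|a - b|) ->
  `|f x - f y - df x * (x - y)| <= L / 2 * (x - y) ^+ 2.
Proof.
move=> fD fL.
suff main (s : R) : `|s| = 1 ->
    0 <= L / 2 * (y - x) ^+ 2 - s * (f y - f x - df x * (y - x)).
  have := main 1; have := main (- 1); rewrite normrN normr1 => /(_ erefl) + /(_ erefl).
  have -> : (x - y) ^+ 2 = (y - x) ^+ 2 by ring.
  by rewrite ler_norml => *; lra.
move=> s1.
pose G z := L / 2 * (z - x) ^+ 2 - s * (f z - f x - df x * (z - x)).
pose dG z := L * (z - x) - s * (df z - df x).
have GD (z : R) : is_derive z 1 G (dG z).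
  by have dz := fD z; apply: is_derive_eq; rewrite /dG /GRing.scale/=; field.
have Gx : G x = 0 by rewrite /G !subrr expr0n/= !mulr0 subr0 mulr0 subr0.
have dGb z : `|s * (df z - df x)| <= L * `|z - x|.
  by rewrite normrM s1 mul1r.
rewrite -[X in X <= _]Gx.
have [xy|/ltW yx] := leP x y.
  apply: (is_derive_ndecr xy (fun z _ => GD z)) => z /andP[xz _].
  have := dGb z; rewrite (ger0_norm (_ : 0 <= z - x)) ?subr_ge0// ler_norml /dG.
  by move=> /andP[_]; lra.
rewrite -lerN2.
apply: (@is_derive_ndecr _ (fun z : R => - G z) (fun z : R => - dG z) _ _ yx).
move=> z /andP[_ zx].
have := dGb z; rewrite (ler0_norm (_ : z - x <= 0)) ?subr_le0// ler_norml /dG.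
by move=> /andP[+ _]; lra.
Qed.

End taylor.

(** * Telescoping along a random ordering of the indices *)

Section averaging.
Context {R : realType}.
Variable n : nat.
Implicit Types (F : {set 'I_n} -> R) (A B : {set 'I_n}) (i : 'I_n).

(** The weight that a set of size [k + 1] receives from its [k + 1] predecessors
equals the weight that it gives to its [n - (k + 1)] successors. *)
Lemma nu_shift (k : nat) : (k.+1 < n)%N ->
  (n%:R * 'C(n.-1, k)%:R)^-1 * k.+1%:R =
  (n%:R * 'C(n.-1, k.+1)%:R)^-1 * (n - k.+1)%:R :> R.
Proof.
case: n => // m; rewrite ltnS subSS /= => km.
have c0 : ('C(m, k)%:R : R) != 0 by rewrite pnatr_eq0 -lt0n bin_gt0 ltnW.
have c1 : ('C(m, k.+1)%:R : R) != 0 by rewrite pnatr_eq0 -lt0n bin_gt0.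
have E : (k.+1%:R * 'C(m, k.+1)%:R : R) = (m - k)%:R * 'C(m, k)%:R.
  by rewrite -!natrM mul_bin_left.
have m0 : (m.+1%:R : R) != 0 by rewrite pnatr_eq0.
move: (m.+1%:R : R) (k.+1%:R : R) ((m - k)%:R : R) ('C(m, k)%:R : R)
  ('C(m, k.+1)%:R : R) m0 c0 c1 E => x y z a b x0 a0 b0 E.
have -> : (x * b)^-1 * z = (x * a * b)^-1 * (z * a) by field; rewrite x0 a0 b0.
by rewrite -E; field; rewrite x0 a0 b0.
Qed.

(** [[set~ i]] is a classical set here, used as a collective predicate, and not the
complement of a singleton in [{set 'I_n}]. *)
Lemma subset_setC1 A i : (A \subset [set~ i]) = (i \notin A).
Proof.
apply/fintype.subsetP/idP => [h|iA x xA].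
  by apply/negP => /h /set_mem; apply.
by apply/mem_set => /= e; move: iA; rewrite -e xA.
Qed.

Lemma nuE A : @nu R n A = (n%:R * 'C(n.-1, #|A|)%:R)^-1.
Proof. by []. Qed.

Lemma sum_nu_fst F :
  \sum_(i < n) \sum_(A : {set 'I_n} | A \subset [set~ i]) nu R A * F A =
  \sum_(A : {set 'I_n}) nu R A * (n - #|A|)%:R * F A.
Proof.
rewrite (exchange_big_dep predT)//=; apply: eq_bigr => A _.
rewrite sumr_const [RHS]mulrAC -[LHS]mulr_natr; congr (_ * _%:R).
have -> : (n - #|A|)%N = #|~: A| by rewrite [RHS]cardsCs finset.setCK card_ord.
by apply: eq_card => i; rewrite [LHS]unfold_in subset_setC1 finset.in_setC.
Qed.

Lemma sum_nu_snd F :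
  \sum_(i < n) \sum_(A : {set 'I_n} | A \subset [set~ i]) nu R A * F (i |: A) =
  \sum_(B : {set 'I_n}) (n%:R * 'C(n.-1, #|B|.-1)%:R)^-1 * #|B|%:R * F B.
Proof.
transitivity (\sum_(i < n) \sum_(B : {set 'I_n} | i \in B)
    (n%:R * 'C(n.-1, #|B|.-1)%:R)^-1 * F B).
  apply: eq_bigr => i _.
  rewrite [RHS](reindex_onto (fun A => i |: A) (fun B => B :\ i)) /=; last first.
    by move=> B iB; exact: finset.setD1K.
  have E A : (A \subset [set~ i]) = (i \in i |: A) && ((i |: A) :\ i == A).
    rewrite finset.setU11 /= subset_setC1; apply/idP/eqP => [iA|<-].
      by rewrite finset.setU1K.
    by rewrite finset.in_setD1 eqxx.
  apply: eq_big => A; first exact: E.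
  rewrite subset_setC1 => iA; congr (_ * _).
  by rewrite nuE cardsU1 iA.
rewrite (exchange_big_dep predT)//=; apply: eq_bigr => B _.
by rewrite sumr_const [RHS]mulrAC -[LHS]mulr_natr.
Qed.

(** [nu A] is the probability that, in a uniformly random ordering of the indices,
[i] comes right after exactly the elements of [A]; the sum is the expectation of
a telescoping sum along that ordering. In the proof, the coefficients of [F B]
cancel for every [B] other than the empty and the full set. *)
Lemma averaged_path_sum F : (0 < n)%N ->
  \sum_(i < n) \sum_(A : {set 'I_n} | A \subset [set~ i])
    nu R A * (F A - F (i |: A)) = F finset.set0 - F finset.setT.
Proof.
move=> n0.
under eq_bigr do (under eq_bigr do rewrite mulrBr; rewrite sumrB).
rewrite sumrB sum_nu_fst sum_nu_snd -sumrB.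
have nR0 : (n%:R : R) != 0 by rewrite pnatr_eq0 -lt0n.
have n0T : (finset.set0 : {set 'I_n}) != finset.setT.
  by rewrite eq_sym -card_gt0 cardsT card_ord.
rewrite (bigD1 finset.set0)//= (bigD1 finset.setT) /=; last by rewrite eq_sym.
rewrite big1 => [|A /andP[A0 AT]].
  rewrite nuE cards0 bin0 subn0 mulr1 mulr0 mul0r subr0 mulVf// mul1r.
  rewrite cardsT card_ord subnn mulr0 mul0r sub0r binn mulr1 mulVf// mul1r.
  by rewrite addr0.
have {A0} A0 : (0 < #|A|)%N by rewrite card_gt0.
have {AT} An : (#|A| < n)%N by rewrite -[X in (_ < X)%N](card_ord n) -cardsT proper_card// properT.
rewrite -mulrBl nuE; case: #|A| A0 An => // k _ kn /=.
by rewrite -nu_shift// subrr mul0r.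
Qed.

Lemma nu_ge0 A : 0 <= nu R A.
Proof. by rewrite nuE invr_ge0 mulr_ge0. Qed.

(** The previous identity for [F A = - (j \in A)], whose increments vanish unless
[i = j]. *)
Lemma sum_nu (j : 'I_n) : \sum_(A : {set 'I_n} | A \subset [set~ j]) nu R A = 1.
Proof.
have n0 : (0 < n)%N by apply: leq_ltn_trans (ltn_ord j).
have E1 : - (j \in finset.set0)%:R - - (j \in finset.setT)%:R = 1 :> R.
  by rewrite !finset.inE /= oppr0 sub0r opprK.
rewrite -[RHS]E1 -(averaged_path_sum (fun A => - (j \in A)%:R) n0).
rewrite (bigD1 j)//= [X in _ + X]big1 ?addr0.
  apply: eq_bigr => A; rewrite subset_setC1 => jA.
  by rewrite finset.setU11 (negbTE jA) oppr0 sub0r opprK mulr1.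
move=> i ij; apply: big1 => A _.
by rewrite !inE [j == i]eq_sym (negbTE ij) /= subrr mulr0.
Qed.

End averaging.

(** * Exchangeability of the two samples *)

Section boxes.
Context (dE : measure_display) (E : measurableType dE) (n : nat).
Local Notation TT := (n.-tuple E * n.-tuple E)%type.
Implicit Types (B C : 'I_n -> set E).

Definition cube B : set (n.-tuple E) := [set x | forall i, B i (tnth x i)].

Definition box B C : set TT := cube B `*` cube C.

(** A pi-system generating the product sigma-algebra, on which independence
computes the joint law of the two samples. *)
Definition boxes : set (set TT) := [set S | exists B C,
  [/\ forall i, measurable (B i), forall i, measurable (C i) & S = box B C]].

Lemma measurable_cube B : (forall i, measurable (B i)) -> measurable (cube B).
Proof.
move=> mB; rewrite (_ : cube B = \bigcap_(i in [set: 'I_n]) ((@tnth _ _)^~ i @^-1` B i)).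
  apply: fin_bigcap_measurable => [|i _]; first exact: finite_finset.
  by rewrite -[X in measurable X]setTI; apply: measurable_tnth.
by apply/seteqP; split => x /= xB i; [move=> _; exact: xB|exact: xB i I].
Qed.

Lemma measurable_box B C : (forall i, measurable (B i)) ->
  (forall i, measurable (C i)) -> measurable (box B C).
Proof. by move=> mB mC; apply: measurableX; exact: measurable_cube. Qed.

Lemma setI_closed_boxes : setI_closed boxes.
Proof.
move=> _ _ [B [C [mB mC ->]]] [B' [C' [mB' mC' ->]]].
exists (fun i => B i `&` B' i), (fun i => C i `&` C' i); split.
- by move=> i; exact: measurableI.
- by move=> i; exact: measurableI.
- apply/seteqP; split => -[x y] /=.
    by move=> [[xB yC] [xB' yC']]; split=> i; split.
  by move=> [xB yC]; split; split => i; [have [] := xB i|have [] := yC i|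
    have [] := xB i|have [] := yC i].
Qed.

Lemma setT_boxes : boxes [set: TT].
Proof.
exists (fun=> setT), (fun=> setT); split => //.
by apply/seteqP; split => // z _; split.
Qed.

(** The identity from the sigma-algebra generated by the boxes to the product one is
measurable, because each of its [2 n] coordinates is. *)
Lemma measurable_boxes : (@measurable _ TT) = <<s boxes >>.
Proof.
apply/seteqP; split; last first.
  apply: smallest_sub; first exact: sigma_algebra_measurable.
  by move=> _ [B [C [mB mC ->]]]; exact: measurable_box.
pose G : measurableType (sigma_display boxes) := g_sigma_algebraType boxes.
suff mid : measurable_fun [set: G] (id : G -> TT).
  by move=> S mS; have := mid measurableT S mS; rewrite setTI preimage_id.
apply/measurable_fun_pairP; split; apply/measurable_fun_tnthP => i _ B mB;
  rewrite setTI; apply: sub_sigma_algebra.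
- exists (fun j => if j == i then B else setT), (fun=> setT); split => //.
    by move=> j; case: ifP.
  apply/seteqP; split => [z /= Bz|z [/(_ i)]]; last by rewrite eqxx.
  by split => // j; case: eqP => // ->.
- exists (fun=> setT), (fun j => if j == i then B else setT); split => //.
    by move=> j; case: ifP.
  apply/seteqP; split => [z /= Bz|z [_ /(_ i)]]; last by rewrite eqxx.
  by split => // j; case: eqP => // ->.
Qed.

Definition swap_pair (A : {set 'I_n}) (z : TT) : TT :=
  (swap z.1 z.2 A, swap z.2 z.1 A).

Lemma measurable_swap (A : {set 'I_n}) :
  measurable_fun [set: TT] (fun z => swap z.1 z.2 A).
Proof.
apply/measurable_fun_tnthP => i.
rewrite (_ : _ \o _ = fun z : TT => if i \in A then tnth z.2 i else tnth z.1 i).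
  case: (i \in A).
    exact: (measurableT_comp (measurable_tnth i) measurable_snd).
  exact: (measurableT_comp (measurable_tnth i) measurable_fst).
by apply/funext => z /=; rewrite tnth_mktuple.
Qed.

Lemma measurable_swap_pair (A : {set 'I_n}) :
  measurable_fun [set: TT] (swap_pair A).
Proof.
apply: measurable_fun_pair; first exact: measurable_swap.
have mC : measurable_fun [set: TT] (fun z : TT => (z.2, z.1)).
  exact: measurable_fun_pair.
exact: (measurableT_comp (measurable_swap A) mC).
Qed.

(** Exchanging the coordinates in [A], then those in [D], exchanges those in the
symmetric difference. *)
Lemma swap_pairD (A D : {set 'I_n}) (x x' : n.-tuple E) :
  swap (swap x x' A) (swap x' x A) D =
  swap x x' ((A :\: D) :|: (D :\: A)).
Proof.
apply: eq_from_tnth => i; rewrite !tnth_mktuple !finset.inE.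
by case: (i \in A); case: (i \in D).
Qed.

End boxes.

Section exchangeable.
Context (R : realType) (d : measure_display) (Omega : measurableType d)
  (P : probability Omega R) (dE : measure_display) (E : measurableType dE)
  (n : nat) (X X' : {RV P >-> n.-tuple E}).
Hypothesis X_indep : mutual_indep P (fun (i : 'I_n) (w : Omega) => tnth (X w) i).
Hypothesis X'_copy : independent_copy X X'.
Local Notation TT := (n.-tuple E * n.-tuple E)%type.

Let mpair : measurable_fun [set: Omega] (fun w => (X w, X' w)).
Proof. exact: measurable_fun_pair. Qed.

Definition pair_rv : {RV P >-> TT} := mfun_Sub (mem_set mpair).

Let mpair_swap (A : {set 'I_n}) :
  measurable_fun [set: Omega] (swap_pair A \o (fun w => (X w, X' w))).
Proof. exact: (measurableT_comp (measurable_swap_pair A)). Qed.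

Definition swap_rv A : {RV P >-> TT} := mfun_Sub (mem_set (mpair_swap A)).

Let P_cube (B : 'I_n -> set E) : (forall i, measurable (B i)) ->
  P (X @^-1` cube B) = (\prod_(i < n) P ((fun w => tnth (X w) i) @^-1` B i))%E.
Proof.
move=> mB; have := X_indep (finset.setT) mB.
rewrite (_ : \bigcap_(i in _) _ = X @^-1` cube B); last first.
  apply/seteqP; split => w /= h i; last by move=> _; exact: h.
  by apply: h; rewrite /= finset.in_setT.
by move=> ->; apply: eq_bigl => i; rewrite finset.in_setT.
Qed.

Let P_box (B C : 'I_n -> set E) :
  (forall i, measurable (B i)) -> (forall i, measurable (C i)) ->
  P (pair_rv @^-1` box B C) =
  (\prod_(i < n) (P ((fun w => tnth (X w) i) @^-1` B i) *
                  P ((fun w => tnth (X w) i) @^-1` C i)))%E.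
Proof.
move=> mB mC; have [XX' law] := X'_copy.
rewrite (_ : _ @^-1` _ = X @^-1` cube B `&` X' @^-1` cube C)//.
rewrite XX'; [|exact: measurable_cube|exact: measurable_cube].
have := law _ (measurable_cube mC).
by rewrite /distribution /pushforward => <-; rewrite !P_cube// big_split.
Qed.

(** On a box both laws are the product of the same [2 n] probabilities, grouped
differently. *)
Lemma distribution_swap (A : {set 'I_n}) (S : set TT) : measurable S ->
  distribution P pair_rv S = distribution P (swap_rv A) S.
Proof.
apply: (measure_unique (@boxes _ E n) (fun=> setT)) => //.
- exact: measurable_boxes.
- exact: setI_closed_boxes.
- by move=> _; exact: setT_boxes.
- by rewrite bigcup_const.
- move=> _ [B [C [mB mC ->]]]; rewrite /distribution /pushforward.
  pose B' i := if i \in A then C i else B i.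
  pose C' i := if i \in A then B i else C i.
  have mB' i : measurable (B' i) by rewrite /B'; case: ifP.
  have mC' i : measurable (C' i) by rewrite /C'; case: ifP.
  rewrite [RHS](_ : _ = P (pair_rv @^-1` box B' C')); last first.
    congr (P _); apply/seteqP; split => w /= [h1 h2]; split=> i; have := h1 i; have := h2 i;
      by rewrite /B' /C' /= !tnth_mktuple; case: ifP.
  rewrite (P_box mB' mC').
  apply: etrans (P_box mB mC) _; apply: eq_bigr => i _; rewrite /B' /C'.
  by case: ifP => // _; rewrite muleC.
- by move=> _; rewrite (le_lt_trans (probability_le1 _ _))// ltry.
Qed.

Lemma ge0_integral_swap (A : {set 'I_n}) (G : TT -> \bar R) :
  measurable_fun setT G -> (forall z, 0 <= G z)%E ->
  (\int[P]_w G (X w, X' w) = \int[P]_w G (swap_pair A (X w, X' w)))%E.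
Proof.
move=> mG G0.
have := @ge0_integral_distribution _ _ _ _ _ P pair_rv G mG G0.
have := @ge0_integral_distribution _ _ _ _ _ P (swap_rv A) G mG G0.
rewrite /comp/= => <- <-.
apply: eq_measure_integral => S mS _; exact: distribution_swap.
Qed.

Lemma integrable_swap (A : {set 'I_n}) (G : TT -> R) : measurable_fun setT G ->
  P.-integrable setT (fun w => (G (X w, X' w))%:E) ->
  P.-integrable setT (fun w => (G (swap_pair A (X w, X' w)))%:E).
Proof.
move=> mG /integrableP[_ Goo]; apply/integrableP; split.
  apply/measurable_EFinP; exact: (measurableT_comp mG (mpair_swap A)).
rewrite -(ge0_integral_swap A (G := fun z => (`|G z|)%:E))//.
by apply/measurable_EFinP; exact: measurableT_comp.
Qed.

Lemma Rintegral_swap (A : {set 'I_n}) (G : TT -> R) : measurable_fun setT G ->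
  \int[P]_w G (X w, X' w) = \int[P]_w G (swap_pair A (X w, X' w)).
Proof.
move=> mG; rewrite /Rintegral integralE [in RHS]integralE.
have mG' : measurable_fun setT (EFin \o G) by exact/measurable_EFinP.
congr (fine (_ - _)).
  have mp := measurable_funepos mG'.
  have := ge0_integral_swap A mp (fun z => funepos_ge0 _ z).
  by rewrite unlock.
have mn := measurable_funeneg mG'.
have := ge0_integral_swap A mn (fun z => funeneg_ge0 _ z).
by rewrite unlock.
Qed.

End exchangeable.

Section independence_product.
Context (R : realType) (d : measure_display) (Omega : measurableType d)
  (P : probability Omega R) (dE : measure_display) (E : measurableType dE)
  (X X' : {RV P >-> E}).
Hypothesis X'_copy : independent_copy X X'.

(** The law of [(X, X')] is a product measure, and the inner integral of Fubini's
theorem vanishes. *)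
Lemma Rintegral_indep_mul_centered (u v : E -> R) :
  measurable_fun setT u -> measurable_fun setT v ->
  P.-integrable setT (fun w => (u (X w) * v (X' w))%:E) ->
  P.-integrable setT (fun w => (v (X w))%:E) ->
  \int[P]_w v (X w) = 0 -> \int[P]_w (u (X w) * v (X' w)) = 0.
Proof.
move=> mu mv iuv iv v0; have [XX' law] := X'_copy.
have mp : measurable_fun [set: Omega] (fun w => (X w, X' w)).
  exact: measurable_fun_pair.
pose Q : {RV P >-> (E * E)%type} := mfun_Sub (mem_set mp).
have prodE (S : set (E * E)) : measurable S ->
    (distribution P X \x distribution P X')%E S = distribution P Q S.
  apply: product_measure_unique => A B mA mB.
  by rewrite /distribution /pushforward -XX'.
pose G (z : E * E) := (u z.1 * v z.2)%:E.
have mG : measurable_fun setT G.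
  apply/measurable_EFinP; apply: measurable_funM.
    exact: (measurableT_comp mu measurable_fst).
  exact: (measurableT_comp mv measurable_snd).
have intvX' : (\int[distribution P X']_y (v y)%:E = 0)%E.
  rewrite -(@eq_measure_integral _ _ _ _ _ (distribution P X)); last first.
    by move=> A mA _; exact: law.
  rewrite integral_distribution//; last exact/measurable_EFinP.
  have fv := integrable_fin_num measurableT iv.
  by rewrite -[LHS](fineK fv) [fine _]v0.
have ivX' : (distribution P X').-integrable setT (fun y => (v y)%:E).
  apply/integrableP; split; first exact/measurable_EFinP.
  rewrite -(@eq_measure_integral _ _ _ _ _ (distribution P X)); last first.
    by move=> A mA _; exact: law.
  have /integrableP[_] := iv.
  rewrite ge0_integral_distribution//.
  by apply/measurable_EFinP; exact: measurableT_comp.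
suff : (\int[P]_w (u (X w) * v (X' w))%:E = 0)%E by rewrite /Rintegral => ->.
have -> : (\int[P]_w (u (X w) * v (X' w))%:E = \int[distribution P Q]_z G z)%E.
  by rewrite integral_distribution.
rewrite -(@eq_measure_integral _ _ _ _ (distribution P Q)
  (distribution P X \x distribution P X')%E); last first.
  by move=> S mS _; exact: prodE.
rewrite -integral12_prod_meas1; last first.
  apply/integrableP; split => //.
  rewrite (@eq_measure_integral _ _ _ _ (distribution P Q)); last first.
    by move=> S mS _; exact: prodE.
  rewrite ge0_integral_distribution//; last exact: measurableT_comp.
  by have /integrableP[_] := iuv.
apply: integral0_eq => x _; rewrite /fubini_F /G/=.
under eq_integral do rewrite EFinM.
by rewrite integralZl// intvX' mule0.
Qed.

End independence_product.

(** * Integrability and conditioning *)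

Section integral_helpers.
Context (R : realType) (d : measure_display) (T : measurableType d)
  (mu : {measure set T -> \bar R}).
Implicit Types (u v : T -> R).

Local Notation int u := (mu.-integrable [set: T] (EFin \o u)).

Lemma integrable_dominated u v : measurable_fun setT u ->
  (forall w, `|u w| <= v w) -> int v -> int u.
Proof.
move=> mu_ uv iv; apply: le_integrable iv => //; first exact/measurable_EFinP.
by move=> w _ /=; rewrite lee_fin (le_trans (uv w))// ler_norm.
Qed.

Lemma integrable_measurable u : int u -> measurable_fun setT u.
Proof. by move=> /measurable_int /measurable_EFinP. Qed.

Lemma integrableD_EFin u v : int u -> int v -> int (fun w => u w + v w).
Proof. by move=> iu iv; exact: (integrableD measurableT iu iv). Qed.

Lemma integrableB_EFin u v : int u -> int v -> int (fun w => u w - v w).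
Proof. by move=> iu iv; exact: (integrableB measurableT iu iv). Qed.

Lemma integrableZl_EFin (k : R) u : int u -> int (fun w => k * u w).
Proof. by move=> iu; exact: (integrableZl measurableT k iu). Qed.

Lemma integrable_norm_EFin u : int u -> int (fun w => `|u w|).
Proof. by move=> iu; exact: (integrable_abse iu). Qed.

Lemma integrable_bounded_mul u v (K : R) : measurable_fun setT u ->
  (forall w, `|u w| <= K) -> int v -> int (fun w => u w * v w).
Proof.
move=> mu_ uK iv; apply: (@integrable_dominated _ (fun w => K * `|v w|)).
- by apply: measurable_funM => //; exact: integrable_measurable.
- by move=> w; rewrite normrM ler_wpM2r.
- by apply: integrableZl_EFin; exact: integrable_norm_EFin.
Qed.

Lemma integrable_mul_sqr u v : measurable_fun setT u -> measurable_fun setT v ->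
  int (fun w => u w ^+ 2) -> int (fun w => v w ^+ 2) -> int (fun w => u w * v w).
Proof.
move=> mu_ mv iu iv.
apply: (@integrable_dominated _ (fun w => u w ^+ 2 + v w ^+ 2)).
- exact: measurable_funM.
- move=> w; rewrite ler_norml; apply/andP; split.
    by have := sqr_ge0 (u w + v w); have := sqr_ge0 (u w); have := sqr_ge0 (v w); nra.
  by have := sqr_ge0 (u w - v w); have := sqr_ge0 (u w); have := sqr_ge0 (v w); nra.
- exact: integrableD_EFin.
Qed.

Lemma integrable_sqrB u v : measurable_fun setT u -> measurable_fun setT v ->
  int (fun w => u w ^+ 2) -> int (fun w => v w ^+ 2) ->
  int (fun w => (u w - v w) ^+ 2).
Proof.
move=> mu_ mv iu iv.
apply: (@integrable_dominated _ (fun w => 2 * u w ^+ 2 + 2 * v w ^+ 2)).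
- by apply: measurable_funX; exact: measurable_funB.
- by move=> w; rewrite ger0_norm ?sqr_ge0//; have := sqr_ge0 (u w + v w); nra.
- by apply: integrableD_EFin; exact: integrableZl_EFin.
Qed.

Lemma integrable_sum_EFin (I : Type) (s : seq I) (Q : pred I) (F : I -> T -> R) :
  (forall i, Q i -> int (F i)) -> int (fun w => \sum_(i <- s | Q i) F i w).
Proof.
move=> iF.
apply: (eq_integrable measurableT _ _ _ (integrable_sum measurableT s iF)).
by move=> w _ /=; rewrite sumEFin.
Qed.

Lemma Rintegral_sum (I : Type) (s : seq I) (Q : pred I) (F : I -> T -> R) :
  (forall i, Q i -> int (F i)) ->
  \int[mu]_w (\sum_(i <- s | Q i) F i w) = \sum_(i <- s | Q i) \int[mu]_w F i w.
Proof.
move=> iF; elim: s => [|i s IH].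
  rewrite big_nil; under eq_Rintegral do rewrite big_nil.
  rewrite /Rintegral -[RHS]/(fine 0); congr fine.
  by apply: integral0_eq.
rewrite big_cons; under eq_Rintegral do rewrite big_cons.
case: ifP => // Qi; rewrite RintegralD ?IH//; first exact: iF.
exact: integrable_sum_EFin.
Qed.

Lemma normr_Rintegral_le u v : int u -> int v -> (forall w, `|u w| <= v w) ->
  `|\int[mu]_w u w| <= \int[mu]_w v w.
Proof.
move=> iu iv uv; apply: le_trans (le_normr_Rintegral measurableT iu) _.
by apply: le_Rintegral => //; exact: integrable_norm_EFin.
Qed.

End integral_helpers.

Lemma integrable_of_sqr (R : realType) (d : measure_display) (T : measurableType d)
    (mu : {finite_measure set T -> \bar R}) (u : T -> R) :
  measurable_fun setT u -> mu.-integrable setT (EFin \o (fun w => u w ^+ 2)) ->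
  mu.-integrable setT (EFin \o u).
Proof.
move=> mu_ iu; apply: (@integrable_dominated _ _ _ _ _ (fun w => 1 + u w ^+ 2)) => //.
  move=> w; rewrite ler_norml; apply/andP; split.
    by have := sqr_ge0 (u w + 1); have := sqr_ge0 (u w); nra.
  by have := sqr_ge0 (u w - 1); have := sqr_ge0 (u w); nra.
by apply: integrableD_EFin => //; exact: finite_measure_integrable_cst.
Qed.

Section conditional.
Context (R : realType) (d : measure_display) (T : measurableType d)
  (mu : {measure set T -> \bar R}).

(** Rounding [k + K] down to a multiple of [1 / (m + 1)] gives a finite combination of
indicators, whose integral against [D] vanishes by hypothesis; the rounding error
contributes at most the integral of [|D|] divided by [m + 1]. *)
Lemma Rintegral_mul_measurable_eq0 (D W : T -> R) (k : R -> R) (K : R) :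
  mu.-integrable setT (EFin \o D) -> measurable_fun setT W ->
  (forall B : set R, measurable B -> \int[mu]_(w in W @^-1` B) D w = 0) ->
  measurable_fun setT k -> (forall x, `|k x| <= K) ->
  \int[mu]_w (k (W w) * D w) = 0.
Proof.
move=> iD mW D0 mk kK.
have K0 : 0 <= K := le_trans (normr_ge0 _) (kK 0).
have mkW : measurable_fun setT (k \o W) by exact: measurableT_comp.
have ikD := integrable_bounded_mul mkW (fun w => kK (W w)) iD.
have iaD := integrable_norm_EFin iD.
apply/eqP; rewrite -normr_eq0 eq_le normr_ge0 andbT.
suff bound (m : nat) : `|\int[mu]_w (k (W w) * D w)| * m.+1%:R <= \int[mu]_w `|D w|.
  rewrite leNgt; apply/negP => c0.
  have := bound (Num.truncn (\int[mu]_w `|D w| / `|\int[mu]_w (k (W w) * D w)|)).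
  rewrite mulrC -ler_pdivlMr// leNgt => /negP; apply.
  exact: truncnS_gt.
pose q x := m.+1%:R * (k x + K).
have q0 x : 0 <= q x.
  by rewrite mulr_ge0//; have := kK x; rewrite ler_norml => /andP[]; lra.
pose N := Num.truncn (m.+1%:R * (2 * K)).
have qN x : (Num.truncn (q x) <= N)%N.
  apply: le_truncn; rewrite ler_wpM2l//.
  by have := kK x; rewrite ler_norml => /andP[]; lra.
pose B (j : nat) : set R := q @^-1` `[j%:R, j.+1%:R[.
have mq : measurable_fun setT q.
  by apply: measurable_funM => //; exact: measurable_funD.
have mB j : measurable (B j) by rewrite -[B j]setTI; exact: mq.
have stepE x : (Num.truncn (q x))%:R =
    \sum_(j < N.+1) j%:R * (x \in B j)%:R :> R.
  have lt : (Num.truncn (q x) < N.+1)%N by rewrite ltnS.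
  have tr := truncn_itv (q0 x).
  rewrite (bigD1 (Ordinal lt))//= big1 ?addr0 => [|j jq].
    by rewrite mem_set ?mulr1//= in_itv.
  rewrite memNset ?mulr0// /B /= in_itv/= => /andP[h1 h2].
  move: jq; rewrite -val_eqE /= => /eqP; apply; apply/eqP.
  by rewrite eq_sym truncn_eq//; apply/andP.
have ind0 (S : set R) : measurable S -> \int[mu]_w ((W w \in S)%:R * D w) = 0.
  move=> mS; rewrite -(D0 _ mS) [RHS]Rintegral_mkcond.
  apply: eq_Rintegral => w _; rewrite patchE.
  have -> : (w \in W @^-1` S) = (W w \in S).
    by apply/idP/idP => /set_mem h; exact/mem_set.
  by case: ifP => _; rewrite ?mul1r ?mul0r.
have iind (S : set R) : measurable S ->
    mu.-integrable setT (EFin \o (fun w => (W w \in S)%:R * D w)).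
  move=> mS; apply: (@integrable_bounded_mul _ _ _ _ _ _ 1) => //.
    have : measurable_fun setT (\1_S \o W : T -> R).
      by apply: measurableT_comp => //; exact: measurable_indic.
    by [].
  by move=> w; case: (_ \in _); rewrite ?normr1 ?normr0.
have step0 : \int[mu]_w ((Num.truncn (q (W w)))%:R * D w) = 0.
  under eq_Rintegral do rewrite stepE mulr_suml.
  rewrite Rintegral_sum => [|j _].
    rewrite big1// => j _; under eq_Rintegral do rewrite -mulrA.
    by rewrite RintegralZl ?ind0 ?mulr0//; exact: iind.
  have := integrableZl_EFin j%:R (iind _ (mB j)).
  by apply: eq_integrable => // w _ /=; rewrite mulrA.
have istep : mu.-integrable setT (EFin \o (fun w => (Num.truncn (q (W w)))%:R * D w)).
  apply: (@integrable_bounded_mul _ _ _ _ _ _ N%:R) => //.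
    under eq_fun do rewrite stepE.
    apply: measurable_sum => j; apply: measurable_funM => //.
    have : measurable_fun setT (\1_(B j) \o W : T -> R).
      by apply: measurableT_comp => //; exact: measurable_indic.
    by [].
  by move=> w; rewrite ger0_norm// ler_nat.
have intD : \int[mu]_w D w = 0 by rewrite -(D0 setT)// preimage_setT.
have iKD : mu.-integrable setT (EFin \o (fun w => m.+1%:R * K * D w)).
  exact: integrableZl_EFin.
have iqD : mu.-integrable setT (EFin \o (fun w => q (W w) * D w)).
  have := integrableD_EFin (integrableZl_EFin m.+1%:R ikD) iKD.
  by apply: eq_integrable => // w _ /=; rewrite /q; congr EFin; ring.
have E : \int[mu]_w (k (W w) * D w) * m.+1%:R =
    \int[mu]_w (q (W w) * D w - (Num.truncn (q (W w)))%:R * D w).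
  rewrite RintegralB// step0 subr0.
  transitivity (\int[mu]_w (m.+1%:R * (k (W w) * D w) + m.+1%:R * K * D w)).
    rewrite RintegralD//; last exact: integrableZl_EFin.
    by rewrite !RintegralZl// intD mulr0 addr0 mulrC.
  by apply: eq_Rintegral => w _; rewrite /q; ring.
rewrite -[X in _ * X](@ger0_norm _ m.+1%:R)// -normrM E.
apply: normr_Rintegral_le => //; first exact: integrableB_EFin.
move=> w; rewrite -mulrBl normrM ler_piMl//.
have /andP[h1 h2] := truncn_itv (q0 (W w)).
rewrite ger0_norm ?subr_ge0// lerBlDr addrC natr1; exact: ltW.
Qed.

End conditional.

(** * The covariance identity *)

Section stein_identity.
Context (R : realType) (d : measure_display) (Omega : measurableType d)
  (P : probability Omega R) (dE : measure_display) (E : measurableType dE)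
  (n : nat) (X X' : {RV P >-> n.-tuple E}).
Hypothesis X_indep : mutual_indep P (fun (i : 'I_n) (w : Omega) => tnth (X w) i).
Hypothesis X'_copy : independent_copy X X'.
Variable f : n.-tuple E -> R.
Hypothesis f_meas : measurable_fun [set: n.-tuple E] f.
Hypothesis n_gt0 : (0 < n)%N.
Local Notation TT := (n.-tuple E * n.-tuple E)%type.
Local Notation int u := (P.-integrable [set: Omega] (EFin \o u)).
Local Notation F A := (fun w => f (swap (X w) (X' w) A)).
Local Notation W := (fun w => f (X w)).
Local Notation T := (fun w => Tstat f (X w) (X' w)).
Local Notation D i := (fun w => Delta f (X w) (X' w) i).
Local Notation DA i A := (fun w => DeltaA f (X w) (X' w) i A).

Lemma swap_set0 (x x' : n.-tuple E) : swap x x' finset.set0 = x.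
Proof. by apply: eq_from_tnth => i; rewrite tnth_mktuple finset.in_set0. Qed.

Lemma swap_setT (x x' : n.-tuple E) : swap x x' finset.setT = x'.
Proof. by apply: eq_from_tnth => i; rewrite tnth_mktuple finset.in_setT. Qed.

Let mfS (A : {set 'I_n}) : measurable_fun [set: TT] (fun z => f (swap z.1 z.2 A)).
Proof. exact: (measurableT_comp f_meas (measurable_swap A)). Qed.

Let mpair : measurable_fun [set: Omega] (fun w => (X w, X' w)).
Proof. exact: measurable_fun_pair. Qed.

Let mF (A : {set 'I_n}) : measurable_fun [set: Omega] (F A).
Proof. exact: (measurableT_comp (mfS A) mpair). Qed.

Let mf1 : measurable_fun [set: TT] (fun z => f z.1).
Proof. exact: (measurableT_comp f_meas measurable_fst). Qed.

Lemma integrable_comp_swap (k : R -> R) (A : {set 'I_n}) : measurable_fun setT k ->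
  int (fun w => k (W w)) -> int (fun w => k (F A w)).
Proof.
move=> mk; apply: (integrable_swap X_indep X'_copy A (G := fun z => k (f z.1))).
exact: (measurableT_comp mk mf1).
Qed.

(** Exchanging the [i]-th coordinates turns [X^A] into [X^(A + i)] and conversely, so
it reverses the increment and replaces [X] by [X^i] inside [phi]. *)
Lemma Rintegral_DeltaA_swap (phi : R -> R) (i : 'I_n) (A : {set 'I_n}) :
  measurable_fun setT phi -> i \notin A ->
  \int[P]_w (phi (W w) * DA i A w) =
  \int[P]_w (- (phi (F [set i]%SET w) * DA i A w)).
Proof.
move=> mphi iA.
pose G (z : TT) := phi (f z.1) *
  (f (swap z.1 z.2 A) - f (swap z.1 z.2 (i |: A))).
have mG : measurable_fun setT G.
  apply: measurable_funM; first exact: (measurableT_comp mphi mf1).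
  by apply: measurable_funB.
rewrite [LHS](Rintegral_swap X_indep X'_copy [set i]%SET mG).
apply: eq_Rintegral => w _; rewrite /G /DeltaA /= !swap_pairD.
have -> : ([set i] :\: A :|: A :\: [set i])%SET = (i |: A)%SET.
  apply/finset.setP => j; rewrite !finset.inE.
  by case: (eqVneq j i) => [->|_]; rewrite ?iA//= ?andbF ?orbF.
have -> : ([set i] :\: (i |: A) :|: (i |: A) :\: [set i])%SET = A.
  apply/finset.setP => j; rewrite !finset.inE.
  by case: (eqVneq j i) => [->|_]; rewrite ?(negbTE iA)//=; case: (_ \in A).
by rewrite -mulrN opprB.
Qed.

Hypothesis iW2 : int (fun w => W w ^+ 2).

Let iF2 A : int (fun w => F A w ^+ 2).
Proof. by apply: (@integrable_comp_swap (fun x => x ^+ 2)) => //; exact: measurable_funX. Qed.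

Let mDA i A : measurable_fun [set: Omega] (DA i A).
Proof. exact: measurable_funB. Qed.

Let iDA2 i A : int (fun w => DA i A w ^+ 2).
Proof. by apply: integrable_sqrB => //; exact: iF2. Qed.

Let DE i w : D i w = DA i finset.set0 w.
Proof. by rewrite /Delta /DeltaA swap_set0 finset.setU0. Qed.

Let mD i : measurable_fun [set: Omega] (D i).
Proof. by under eq_fun do rewrite DE; exact: mDA. Qed.

Let iD2 i : int (fun w => D i w ^+ 2).
Proof. by under eq_fun do rewrite DE; exact: iDA2. Qed.

Section identity.
Variable phi : R -> R.
Hypothesis mphi : measurable_fun setT phi.
Hypothesis iphi2 : int (fun w => phi (W w) ^+ 2).

Let mphiF A : measurable_fun [set: Omega] (fun w => phi (F A w)).
Proof. exact: (measurableT_comp mphi (mF A)). Qed.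

Let iphiF2 A : int (fun w => phi (F A w) ^+ 2).
Proof.
apply: (@integrable_comp_swap (fun x => phi x ^+ 2)) => //; exact: measurable_funX.
Qed.

Let mphiW : measurable_fun [set: Omega] (fun w => phi (W w)).
Proof. by apply: (measurableT_comp mphi); exact: (measurableT_comp f_meas). Qed.

Let iphiDA A i B : int (fun w => phi (F A w) * DA i B w).
Proof. exact: integrable_mul_sqr. Qed.

Let iphiWDA i B : int (fun w => phi (W w) * DA i B w).
Proof. exact: integrable_mul_sqr. Qed.

Lemma Rintegral_DeltaA_symm (i : 'I_n) (A : {set 'I_n}) : i \notin A ->
  \int[P]_w (phi (W w) * DA i A w) =
  2^-1 * \int[P]_w ((phi (W w) - phi (F [set i]%SET w)) * DA i A w).
Proof.
move=> iA; set I0 := LHS.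
have -> : \int[P]_w ((phi (W w) - phi (F [set i]%SET w)) * DA i A w) = I0 + I0.
  rewrite {2}/I0 Rintegral_DeltaA_swap// -RintegralD//.
    by apply: eq_Rintegral => w _; rewrite mulrBl.
  have := integrableZl_EFin (-1) (iphiDA [set i]%SET i A).
  by apply: eq_integrable => // w _ /=; rewrite mulN1r.
by field.
Qed.

Hypothesis EW0 : \int[P]_w W w = 0.

(** [f X'] is centered and independent of [X], so [W] can be replaced by
[f X - f X'], which is then expanded by telescoping and symmetrized term by
term. *)
Lemma stein_covariance_identity :
  \int[P]_w (phi (W w) * W w) =
  2^-1 * \sum_(i < n) \sum_(A : {set 'I_n} | A \subset [set~ i])
    nu R A * \int[P]_w ((phi (W w) - phi (F [set i]%SET w)) * DA i A w).
Proof.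
have mW : measurable_fun [set: Omega] W by exact: (measurableT_comp f_meas).
have mW' : measurable_fun [set: Omega] (fun w => f (X' w)).
  exact: (measurableT_comp f_meas).
have iW'2 : int (fun w => f (X' w) ^+ 2).
  have := iF2 finset.setT; apply: eq_integrable => // w _ /=.
  by rewrite swap_setT.
have iphiW : int (fun w => phi (W w) * W w) by exact: integrable_mul_sqr.
have iphiW' : int (fun w => phi (W w) * f (X' w)) by exact: integrable_mul_sqr.
have iW : int W by exact: integrable_of_sqr.
have indep0 : \int[P]_w (phi (W w) * f (X' w)) = 0.
  apply: (Rintegral_indep_mul_centered X'_copy (u := phi \o f) (v := f)) => //.
  exact: measurableT_comp.
transitivity (\int[P]_w (phi (W w) * W w) - \int[P]_w (phi (W w) * f (X' w))).
  by rewrite indep0 subr0.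
rewrite -RintegralB//.
transitivity (\int[P]_w (\sum_(i < n) \sum_(A : {set 'I_n} | A \subset [set~ i])
    nu R A * (phi (W w) * DA i A w))).
  apply: eq_Rintegral => w _; rewrite -mulrBr.
  have := averaged_path_sum (fun A => F A w) n_gt0.
  rewrite swap_set0 swap_setT => <-; rewrite mulr_sumr; apply: eq_bigr => i _.
  by rewrite mulr_sumr; apply: eq_bigr => A _; rewrite mulrCA.
rewrite Rintegral_sum => [|i _]; last first.
  by apply: integrable_sum_EFin => A _; exact: integrableZl_EFin.
rewrite mulr_sumr; apply: eq_bigr => i _.
rewrite Rintegral_sum => [|A _]; last exact: integrableZl_EFin.
rewrite mulr_sumr; apply: eq_bigr => A; rewrite subset_setC1 => iA.
by rewrite RintegralZl// Rintegral_DeltaA_symm// mulrCA.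
Qed.

End identity.

Lemma Rintegral_mul_Tstat (k : R -> R) (K : R) : measurable_fun setT k ->
  (forall x, `|k x| <= K) ->
  \int[P]_w (k (W w) * T w) =
  2^-1 * \sum_(i < n) \sum_(A : {set 'I_n} | A \subset [set~ i])
    nu R A * \int[P]_w (k (W w) * D i w * DA i A w).
Proof.
move=> mk kK.
have mkW : measurable_fun [set: Omega] (fun w => k (W w)).
  by apply: (measurableT_comp mk); exact: (measurableT_comp f_meas).
have iDD i A : int (fun w => k (W w) * D i w * DA i A w).
  have := integrable_bounded_mul mkW (fun w => kK _)
    (integrable_mul_sqr (mD i) (mDA i A) (iD2 i) (iDA2 i A)).
  by apply: eq_integrable => // w _ /=; rewrite mulrA.
transitivity (\int[P]_w (2^-1 * (\sum_(i < n) \sum_(A : {set 'I_n} | A \subset [set~ i])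
    nu R A * (k (W w) * D i w * DA i A w)))).
  apply: eq_Rintegral => w _; rewrite /Tstat mulrCA; congr (_ * _).
  rewrite mulr_sumr; apply: eq_bigr => i _.
  by rewrite mulr_sumr; apply: eq_bigr => A _; ring.
have isum i : int (fun w => \sum_(A : {set 'I_n} | A \subset [set~ i])
    nu R A * (k (W w) * D i w * DA i A w)).
  by apply: integrable_sum_EFin => A _; exact: integrableZl_EFin.
rewrite RintegralZl//; last exact: integrable_sum_EFin.
congr (_ * _); rewrite Rintegral_sum//; apply: eq_bigr => i _.
rewrite Rintegral_sum => [|A _]; last exact: integrableZl_EFin.
by apply: eq_bigr => A _; rewrite RintegralZl.
Qed.

Lemma integrable_Tstat : int T.
Proof.
have iDD i A : int (fun w => nu R A * D i w * DA i A w).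
  have := integrableZl_EFin (nu R A)
    (integrable_mul_sqr (mD i) (mDA i A) (iD2 i) (iDA2 i A)).
  by apply: eq_integrable => // w _ /=; rewrite mulrA.
apply: integrableZl_EFin; apply: integrable_sum_EFin => i _.
by apply: integrable_sum_EFin => A _; exact: iDD.
Qed.

(** The covariance identity for the identity function. *)
Lemma Rintegral_Tstat : \int[P]_w W w = 0 ->
  \int[P]_w T w = \int[P]_w (W w ^+ 2).
Proof.
move=> EW0.
transitivity (\int[P]_w (1 * T w)); first by apply: eq_Rintegral => w _; rewrite mul1r.
rewrite (@Rintegral_mul_Tstat (cst 1) 1)//; last by move=> x; rewrite normr1.
rewrite (_ : \int[P]_w (W w ^+ 2) = \int[P]_w (idfun (W w) * W w)); last first.
  by apply: eq_Rintegral => w _; rewrite expr2.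
rewrite (stein_covariance_identity (phi := idfun) (@measurable_id _ _ _) iW2 EW0).
congr (_ * _); apply: eq_bigr => i _; apply: eq_bigr => A _; congr (_ * _).
by apply: eq_Rintegral => w _; rewrite mul1r.
Qed.

Section third_moment.
Hypothesis iD3 : forall i, int (fun w => `|D i w| ^+ 3).

Let G3 i (z : TT) : R := `|Delta f z.1 z.2 i| ^+ 3.

Let mG3 i : measurable_fun [set: TT] (G3 i).
Proof.
apply: measurable_funX; apply: measurableT_comp => //.
by apply: measurable_funB => //; exact: mfS.
Qed.

Let swap_G3 (i : 'I_n) (A : {set 'I_n}) w : i \notin A ->
  G3 i (swap_pair A (X w, X' w)) = `|DA i A w| ^+ 3.
Proof.
move=> iA; rewrite /G3 /Delta /DeltaA /= swap_pairD.
congr (`|_ - f (swap _ _ _)| ^+ 3); apply/finset.setP => j; rewrite !finset.inE.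
by case: (eqVneq j i) => [->|_]; rewrite ?iA ?(negbTE iA)//= ?andbF ?orbF.
Qed.

Lemma integrable_DeltaA3 (i : 'I_n) (A : {set 'I_n}) : i \notin A ->
  int (fun w => `|DA i A w| ^+ 3).
Proof.
move=> iA; have := integrable_swap X_indep X'_copy A (mG3 i) (iD3 i).
by apply: eq_integrable => // w _ /=; rewrite swap_G3.
Qed.

(** Exchanging the coordinates in [A] turns [Delta f] into [DeltaA f A]. *)
Lemma Rintegral_DeltaA3 (i : 'I_n) (A : {set 'I_n}) : i \notin A ->
  \int[P]_w (`|DA i A w| ^+ 3) = \int[P]_w (`|D i w| ^+ 3).
Proof.
move=> iA; rewrite [RHS](Rintegral_swap X_indep X'_copy A (mG3 i)).
by apply: eq_Rintegral => w _; rewrite swap_G3.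
Qed.

(** Both integrals are the same weighted sums, of [phi W - phi W^i] and of
[dphi W * Delta f] respectively, against [DeltaA f]. Term by term they differ by
at most [L / 2] times the integral of [|Delta f| ^ 2 * |DeltaA f|], and Young's
inequality bounds this product by cubes, which have the same integral. *)
Lemma stein_remainder (phi dphi : R -> R) (K K' L : R) : 0 <= L ->
  measurable_fun setT phi -> measurable_fun setT dphi ->
  (forall x, `|phi x| <= K) -> (forall x, `|dphi x| <= K') ->
  (forall x y, `|phi x - phi y - dphi x * (x - y)| <= L / 2 * (x - y) ^+ 2) ->
  \int[P]_w W w = 0 ->
  `|\int[P]_w (phi (W w) * W w) - \int[P]_w (dphi (W w) * T w)| <=
  L / 4 * \sum_(i < n) \int[P]_w (`|D i w| ^+ 3).
Proof.
move=> L0 mphi mdphi phiK dphiK' taylor EW0.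
have mW : measurable_fun [set: Omega] W by exact: (measurableT_comp f_meas).
have iphi2 : int (fun w => phi (W w) ^+ 2).
  apply: (@integrable_dominated _ _ _ _ _ (cst (K ^+ 2))).
  - by apply: measurable_funX; exact: measurableT_comp.
  - move=> w; rewrite normrX lerXn2r ?nnegrE//.
    exact: le_trans (normr_ge0 _) (phiK 0).
  - exact: finite_measure_integrable_cst.
rewrite stein_covariance_identity// (Rintegral_mul_Tstat mdphi dphiK').
rewrite -mulrBr -sumrB normrM ger0_norm ?invr_ge0//.
have -> : L / 4 * \sum_(i < n) \int[P]_w (`|D i w| ^+ 3) =
    2^-1 * \sum_(i < n) L / 2 * \int[P]_w (`|D i w| ^+ 3).
  by rewrite -mulr_sumr mulrA; congr (_ * _); field.
rewrite ler_wpM2l ?invr_ge0//.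
apply: le_trans (ler_norm_sum _ _ _) _; apply: ler_sum => i _.
rewrite -sumrB -[leRHS]mul1r -[X in X * _](@sum_nu R n i) mulr_suml.
apply: le_trans (ler_norm_sum _ _ _) _; apply: ler_sum => A.
rewrite subset_setC1 => iA.
rewrite -mulrBr normrM (ger0_norm (nu_ge0 _)) ler_wpM2l ?nu_ge0//.
have mphiF B : measurable_fun [set: Omega] (fun w => phi (F B w)).
  exact: (measurableT_comp mphi (mF B)).
have i1 : int (fun w => (phi (W w) - phi (F [set i]%SET w)) * DA i A w).
  have iphiF : int (fun w => phi (F [set i]%SET w) ^+ 2).
    apply: (@integrable_comp_swap (fun x => phi x ^+ 2)) => //.
    exact: measurable_funX.
  apply: integrable_mul_sqr => //; last first.
    by apply: integrable_sqrB => //; exact: measurableT_comp.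
  by apply: measurable_funB => //; exact: measurableT_comp.
have i2 : int (fun w => dphi (W w) * D i w * DA i A w).
  have := integrable_bounded_mul (measurableT_comp mdphi mW) (fun w => dphiK' _)
    (integrable_mul_sqr (mD i) (mDA i A) (iD2 i) (iDA2 i A)).
  by apply: eq_integrable => // w _ /=; rewrite mulrA.
rewrite -RintegralB//.
have i3 : int (fun w => 2 / 3 * (`|D i w| ^+ 3) + 1 / 3 * (`|DA i A w| ^+ 3)).
  by apply: integrableD_EFin; apply: integrableZl_EFin => //; exact: integrable_DeltaA3.
have -> : L / 2 * \int[P]_w (`|D i w| ^+ 3) = \int[P]_w (L / 2 *
    (2 / 3 * (`|D i w| ^+ 3) + 1 / 3 * (`|DA i A w| ^+ 3))).
  rewrite RintegralZl// RintegralD//; last 2 first.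
    exact: integrableZl_EFin.
    by apply: integrableZl_EFin; exact: integrable_DeltaA3.
  rewrite !RintegralZl//; last exact: integrable_DeltaA3.
  by rewrite Rintegral_DeltaA3// -mulrDl; congr (_ * _); field.
apply: normr_Rintegral_le => //; [exact: integrableB_EFin|exact: integrableZl_EFin|].
move=> w; rewrite -mulrBl normrM.
have := taylor (W w) (F [set i]%SET w).
rewrite -[W w - F [set i]%SET w]/(D i w) -(real_normK (num_real (D i w))).
set a := `|D i w|; set b := `|DA i A w|.
have a0 : 0 <= a by exact: normr_ge0.
have b0 : 0 <= b by exact: normr_ge0.
move=> h; apply: le_trans (ler_wpM2r b0 h) _.
have -> : L / 2 * a ^+ 2 * b = L / 2 * (a ^+ 2 * b) by ring.
rewrite ler_wpM2l ?divr_ge0// -subr_ge0.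
have -> : 2 / 3 * a ^+ 3 + 1 / 3 * b ^+ 3 - a ^+ 2 * b =
    (a - b) ^+ 2 * (2 * a + b) / 3 by field.
by rewrite divr_ge0// mulr_ge0 ?sqr_ge0// addr_ge0// mulr_ge0.
Qed.

End third_moment.
End stein_identity.

(** * From smooth test functions to distribution functions *)

Section kolmogorov.
Context (R : realType) (d : measure_display) (Omega : measurableType d)
  (P : probability Omega R) (dE : measure_display) (E : measurableType dE)
  (n : nat) (X X' : {RV P >-> n.-tuple E}).
Hypothesis X_indep : mutual_indep P (fun (i : 'I_n) (w : Omega) => tnth (X w) i).
Hypothesis X'_copy : independent_copy X X'.
Variable f : n.-tuple E -> R.
Hypothesis f_meas : measurable_fun [set: n.-tuple E] f.
Hypothesis n_gt0 : (0 < n)%N.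
Local Notation int u := (P.-integrable [set: Omega] (EFin \o u)).
Local Notation W := (fun w => f (X w)).
Local Notation T := (fun w => Tstat f (X w) (X' w)).
Local Notation D i := (fun w => Delta f (X w) (X' w) i).
Hypothesis iW2 : int (fun w => W w ^+ 2).
Hypothesis EW0 : \int[P]_w W w = 0.
Variable Y : Omega -> R.
Hypothesis Y_cond : is_cond_exp P T W Y.
Hypothesis iV : int (fun w => (Y w - 1) ^+ 2).
Hypothesis iD3 : forall i, int (fun w => `|D i w| ^+ 3).

(** The quantity under the square root in the theorem, in the case where it is
finite; [1] is the mean of [Y]. *)
Definition stein_bound : R := Num.sqrt (\int[P]_w ((Y w - 1) ^+ 2)) +
  4^-1 * \sum_(i < n) \int[P]_w (`|D i w| ^+ 3).

Lemma stein_bound_ge0 : 0 <= stein_bound.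
Proof.
rewrite addr_ge0 ?sqrtr_ge0// mulr_ge0 ?invr_ge0//.
by apply: sumr_ge0 => i _; apply: Rintegral_ge0 => w _; exact: exprn_ge0.
Qed.

Let mW : measurable_fun [set: Omega] W.
Proof. exact: (measurableT_comp f_meas). Qed.

Let iY : int Y.
Proof. by case: Y_cond. Qed.

Let iT : int T.
Proof. exact: (integrable_Tstat X_indep X'_copy f_meas iW2). Qed.

Let cond0 (k : R -> R) (K : R) : measurable_fun setT k -> (forall x, `|k x| <= K) ->
  \int[P]_w (k (W w) * (Y w - T w)) = 0.
Proof.
move=> mk kK.
apply: (Rintegral_mul_measurable_eq0 (D := fun w => Y w - T w) (W := W) (K := K)) => //.
  exact: integrableB_EFin.
move=> B mB; have mWB : measurable (W @^-1` B) by rewrite -[_ @^-1` _]setTI; exact: mW.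
rewrite RintegralB//; [|exact: integrableS iY|exact: integrableS iT].
by have [_ _ h] := Y_cond; rewrite /Rintegral h// subrr.
Qed.

Let mean_abs : \int[P]_w `|1 - Y w| <= Num.sqrt (\int[P]_w ((Y w - 1) ^+ 2)).
Proof.
(* Cauchy-Schwarz, from the variance of [|1 - Y|] being nonnegative. *)
set m := \int[P]_w `|1 - Y w|.
have i1 : int (fun w => `|1 - Y w|).
  apply: integrable_norm_EFin; apply: integrableB_EFin => //.
  exact: finite_measure_integrable_cst.
have m0 : 0 <= m by apply: Rintegral_ge0 => w _.
have : 0 <= \int[P]_w ((`|1 - Y w| - m) ^+ 2).
  by apply: Rintegral_ge0 => w _; exact: sqr_ge0.
have -> : \int[P]_w ((`|1 - Y w| - m) ^+ 2) =
    \int[P]_w ((Y w - 1) ^+ 2 + - (2 * m) * `|1 - Y w| + m ^+ 2).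
  apply: eq_Rintegral => w _.
  rewrite -[(Y w - 1) ^+ 2](real_normK (num_real _)) distrC; ring.
have icst : int (fun=> m ^+ 2) by exact: finite_measure_integrable_cst.
have i2 : int (fun w => - (2 * m) * `|1 - Y w|) by exact: integrableZl_EFin.
rewrite RintegralD//; last exact: integrableD_EFin.
rewrite RintegralD// RintegralZl// -/m Rintegral_cst//.
rewrite [X in fine X]probability_setT/= mulr1 => h.
rewrite -[leLHS]ger0_norm// -sqrtr_sqr ler_sqrt; last first.
  by apply: Rintegral_ge0 => w _; exact: sqr_ge0.
by move: h; nra.
Qed.

(** The error splits into the remainder of the covariance identity and
[dphi W * (1 - T)]. In the latter [T] can be replaced by its conditional
expectation [Y], because [dphi W] is a function of [W]. *)
Lemma hinge_mean_distance (s eps : R) : 0 < eps -> eps <= 3 / 5 ->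
  `|\int[P]_w hinge s eps (W w) - normal_mean (hinge s eps)| <= 2 / eps * stein_bound.
Proof.
move=> eps0 eps1; set h := hinge s eps.
have ch : continuous h by exact: continuous_hinge.
have [phi [dphi [phiD dphiE phiK dphiK dphiL]]] := stein_solution ch
  (hinge01 s eps) (hinge_nincr s eps0) eps0 eps1 (hinge_lip s eps0).
have L0 : 0 <= 2 / eps by rewrite divr_ge0// ltW.
have taylor x y : `|phi x - phi y - dphi x * (x - y)| <= 2 / eps / 2 * (x - y) ^+ 2.
  exact: taylor_lipschitz.
have cphi : continuous phi.
  by move=> x; apply: differentiable_continuous; apply/derivable1_diffP; case: (phiD x).
have mphi : measurable_fun setT phi by exact: continuous_measurable_fun.
have mh : measurable_fun setT h by exact: continuous_measurable_fun.
have mdphi : measurable_fun setT dphi.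
  rewrite (_ : dphi = fun w => w * phi w + (h w - normal_mean h)); last first.
    by apply/funext => w; exact: dphiE.
  by apply: measurable_funD; [exact: measurable_funM|exact: measurable_funB].
have := stein_remainder X_indep X'_copy f_meas n_gt0 iW2 iD3 L0 mphi mdphi phiK dphiK
  taylor EW0.
have mdW : measurable_fun [set: Omega] (fun w => dphi (W w)) by exact: measurableT_comp.
have i1 : int (fun w => 1 : R) by exact: finite_measure_integrable_cst.
have idY : int (fun w => dphi (W w) * Y w).
  exact: (integrable_bounded_mul mdW (fun w => dphiK _)).
have idT : int (fun w => dphi (W w) * T w).
  exact: (integrable_bounded_mul mdW (fun w => dphiK _)).
have id1 : int (fun w => dphi (W w)).
  by have := integrable_bounded_mul mdW (fun w => dphiK _) i1;
    apply: eq_integrable => // w _ /=; rewrite mulr1.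
have iphiW : int (fun w => phi (W w) * W w).
  apply: (integrable_bounded_mul _ (fun w => phiK _)); first exact: measurableT_comp.
  exact: integrable_of_sqr.
have ih : int (fun w => h (W w)).
  have mhW : measurable_fun setT (fun w => h (W w)) by exact: measurableT_comp.
  have := integrable_bounded_mul mhW (fun w => norm_hinge s eps _) i1.
  by apply: eq_integrable => // w _ /=; rewrite mulr1.
have -> : \int[P]_w (dphi (W w) * T w) = \int[P]_w (dphi (W w) * Y w).
  apply/esym/eqP; rewrite -subr_eq0 -RintegralB//.
  rewrite -[X in _ == X](cond0 mdphi dphiK); apply/eqP.
  by apply: eq_Rintegral => w _; rewrite mulrBr.
have hE : \int[P]_w h (W w) - normal_mean h =
    \int[P]_w dphi (W w) - \int[P]_w (phi (W w) * W w).
  rewrite -RintegralB//.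
  transitivity (\int[P]_w (h (W w) - normal_mean h)).
    rewrite RintegralB//; last exact: finite_measure_integrable_cst.
    by rewrite Rintegral_cst// [X in fine X]probability_setT/= mulr1.
  by apply: eq_Rintegral => w _; rewrite dphiE; ring.
have dY : `|\int[P]_w dphi (W w) - \int[P]_w (dphi (W w) * Y w)| <=
    2 / eps * \int[P]_w `|1 - Y w|.
  rewrite -RintegralB//.
  have i1Y : int (fun w => `|1 - Y w|).
    by apply: integrable_norm_EFin; exact: integrableB_EFin.
  rewrite -RintegralZl//; apply: normr_Rintegral_le.
  - exact: integrableB_EFin.
  - exact: integrableZl_EFin.
  - move=> w; rewrite (_ : _ - _ = dphi (W w) * (1 - Y w)); last by ring.
    by rewrite normrM ler_wpM2r.
rewrite hE => rem.
have -> : \int[P]_w dphi (W w) - \int[P]_w (phi (W w) * W w) =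
  (\int[P]_w dphi (W w) - \int[P]_w (dphi (W w) * Y w)) -
  (\int[P]_w (phi (W w) * W w) - \int[P]_w (dphi (W w) * Y w)) by ring.
apply: le_trans (ler_normB _ _) _.
have := ler_wpM2l L0 mean_abs.
have -> : 2 / eps * stein_bound = 2 / eps * Num.sqrt (\int[P]_w ((Y w - 1) ^+ 2)) +
    2 / eps / 4 * \sum_(i < n) \int[P]_w (`|D i w| ^+ 3).
  by rewrite /stein_bound mulrDr mulrA.
lra.
Qed.

Lemma hinge_bounds (s eps : R) : 0 < eps -> forall w,
  \1_[set w | W w <= s] w <= hinge s eps (W w) <= \1_[set w | W w <= s + eps] w.
Proof.
move=> eps0 w; rewrite !indicE; have /andP[h0 h1] := hinge01 s eps (W w).
apply/andP; split.
  have [ws|ws] := leP (W w) s; first by rewrite hinge1// mem_set.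
  by rewrite memNset//=; apply/negP; rewrite -ltNge.
have [ws|ws] := leP (W w) (s + eps); first by rewrite mem_set.
by rewrite hinge0// ?ltW// memNset//=; apply/negP; rewrite -ltNge.
Qed.

(** The indicator of [w <= t] lies between the hinges starting at [t - eps] and
at [t]. *)
Lemma cdf_distance (t eps : R) : 0 < eps -> eps <= 3 / 5 ->
  `|fine (P [set w | W w <= t]) - normal_cdf t| <= 2 / eps * stein_bound + eps / 4.
Proof.
move=> eps0 eps1.
have mS (s : R) : measurable [set w | W w <= s].
  have -> : [set w | W w <= s] = W @^-1` `]-oo, s].
    by apply/seteqP; split => w /=; rewrite in_itv.
  by rewrite -[_ @^-1` _]setTI; apply: mW.
have PE (s : R) : fine (P [set w | W w <= s]) =
    \int[P]_w (\1_[set w | W w <= s] w).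
  by rewrite /Rintegral integral_indic// setIT.
have i1 (s : R) : int (\1_[set w | W w <= s] : Omega -> R).
  exact: integrable_indic.
have ih (s : R) : int (fun w => hinge s eps (W w)).
  have mhW : measurable_fun setT (fun w => hinge s eps (W w)).
    apply: (measurableT_comp _ mW); apply: continuous_measurable_fun.
    exact: continuous_hinge.
  have icst : int (fun w => 1 : R) by exact: finite_measure_integrable_cst.
  have := integrable_bounded_mul mhW (fun w => norm_hinge s eps _) icst.
  by apply: eq_integrable => // w _ /=; rewrite mulr1.
have up : fine (P [set w | W w <= t]) <= \int[P]_w hinge t eps (W w).
  by rewrite PE; apply: le_Rintegral => // w _; have /andP[] := hinge_bounds t eps0 w.
have lo : \int[P]_w hinge (t - eps) eps (W w) <= fine (P [set w | W w <= t]).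
  rewrite PE; apply: le_Rintegral => // w _.
  by have /andP[_] := hinge_bounds (t - eps) eps0 w; rewrite subrK.
have := hinge_mean_distance t eps0 eps1.
have := hinge_mean_distance (t - eps) eps0 eps1.
rewrite !ler_norml => /andP[b1 _] /andP[_ b2].
have := normal_mean_hinge_le t eps0.
have := normal_cdf_le_normal_mean_hinge (t - eps) eps0; rewrite subrK => n1 n2.
apply/andP; split; lra.
Qed.

End kolmogorov.

(** For [0 < sqrt q < 1 / 2] the choice [eps = 6 / 5 * sqrt q] is allowed and gives
[(5 / 3 + 3 / 10) * sqrt q]; for larger [q] the bound [x <= 1] suffices, and for
[q = 0] a small [eps] contradicts [0 < x]. *)
Lemma smoothing_optimum (R : rcfType) (x q : R) : 0 <= q -> x <= 1 ->
  (forall eps, 0 < eps -> eps <= 3 / 5 -> x <= 2 / eps * q + eps / 4) ->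
  x <= 2 * Num.sqrt q.
Proof.
move=> q0 x1 xe; set r := Num.sqrt q.
have r0 : 0 <= r by exact: sqrtr_ge0.
have qE : q = r ^+ 2 by rewrite sqr_sqrtr.
have [r1|r1] := leP 2^-1 r; first lra.
have [rp|] := ltP 0 r.
  have e0 : 0 < 6 / 5 * r by lra.
  have := xe _ e0; rewrite qE.
  have -> : 2 / (6 / 5 * r) * r ^+ 2 = 5 / 3 * r by field; rewrite gt_eqF.
  by move=> h; apply: le_trans (h _) _; lra.
move=> rn; have r00 : r = 0 by apply/eqP; rewrite eq_le rn.
rewrite r00 mulr0 leNgt; apply/negP => xp.
have [xs|xs] := leP x (3 / 5).
  by have := xe x xp xs; rewrite qE r00 expr0n/= mulr0; lra.
have e0 : (0 : R) < 3 / 5 by lra.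
by have := xe _ e0 (lexx _); rewrite qE r00 expr0n/= mulr0; lra.
Qed.

Theorem theorem3p1 (R : realType)
    (d : measure_display) (Omega : measurableType d) (P : probability Omega R)
    (dE : measure_display) (E : measurableType dE) (n : nat)
    (X X' : {RV P >-> n.-tuple E})
    (X_indep : mutual_indep P (fun (i : 'I_n) (w : Omega) => tnth (X w) i))
    (X'_copy : independent_copy X X')
    (f : n.-tuple E -> R) (f_meas : measurable_fun [set: n.-tuple E] f)
    (W : Omega -> R) (W_def : W = (fun w => f (X w)))
    (EW : 'E_P[W]%E = 0%E) (EW2 : ('E_P[(fun w => W w ^+ 2)%R])%E = 1%E)
    (dZ : measure_display) (OmegaZ : measurableType dZ)
    (PZ : probability OmegaZ R) (Z : {RV PZ >-> R})
    (Z_normal : standard_normal Z)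
    (Y : Omega -> R)
    (Y_cond : is_cond_exp P (fun w => Tstat f (X w) (X' w)) W Y) :
  (ereal_sup [set `|P [set w | (W w <= t)%R] - PZ [set w | (Z w <= t)%R]|
              | t in [set: R]]
   <= 2%:E * (sqrte 'V_P[Y]
              + 4^-1%:E * \sum_(i < n)
                  'E_P[(fun w => `|Delta f (X w) (X' w) i| ^+ 3)%R]) `^ 2^-1)%E.
Proof.
subst W; pose W := fun w => f (X w).
change ('E_P[W] = 0)%E in EW.
change ('E_P[(fun w => W w ^+ 2)%R] = 1)%E in EW2.
have mW : measurable_fun [set: Omega] W by exact: (measurableT_comp f_meas).
(* For [n = 0] the variable [W] is constant, which contradicts its two moments. *)
have n_gt0 : (0 < n)%N.
  rewrite lt0n; apply/negP => /eqP n0; subst n.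
  have Wc : W = cst (f [tuple]) by apply/funext => w; rewrite /W tuple0.
  move: EW EW2; rewrite Wc expectation_cst => -[f0].
  rewrite (_ : (fun w => cst (f [tuple]) w ^+ 2) = cst 0); last first.
    by apply/funext => w /=; rewrite f0 expr0n.
  by rewrite expectation_cst => -[/eqP]; rewrite eq_sym oner_eq0.
have iW2 : P.-integrable [set: Omega] (EFin \o (fun w => W w ^+ 2)).
  apply/integrableP; split; first by apply/measurable_EFinP; exact: measurable_funX.
  under eq_integral do rewrite /= ger0_norm ?sqr_ge0//.
  by move: EW2; rewrite unlock => ->; rewrite ltry.
have EW0 : \int[P]_w W w = 0.
  by move: EW; rewrite unlock /Rintegral => ->.
have EW21 : \int[P]_w (W w ^+ 2) = 1.
  by move: EW2; rewrite unlock /Rintegral => ->.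
have EY : ('E_P[Y] = 1)%E.
  have [_ _ h] := Y_cond; have := h setT measurableT.
  rewrite preimage_setT unlock => ->.
  have iT := integrable_Tstat X_indep X'_copy f_meas iW2.
  rewrite -[LHS]fineK; last exact: integrable_fin_num iT.
  rewrite [fine _](Rintegral_Tstat X_indep X'_copy f_meas n_gt0 iW2 EW0).
  by rewrite EW21.
have iY : P.-integrable [set: Omega] (EFin \o Y) by case: Y_cond.
have mY := integrable_measurable iY.
have VE : ('V_P[Y] = \int[P]_w ((Y w - 1) ^+ 2)%:E)%E.
  rewrite /variance unlock EY unlock.
  by apply: eq_integral => w _ /=; rewrite expr2.
set V := 'V_P[Y]%E in VE *; set S := (\sum_(i < n) _)%E.
have V0 : (0 <= V)%E by exact: variance_ge0.
have ED0 i : (0 <= 'E_P[(fun w => `|Delta f (X w) (X' w) i| ^+ 3)%R])%E.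
  by apply: expectation_ge0 => w; exact: exprn_ge0.
have S0 : (0 <= S)%E by apply: sume_ge0 => i _; exact: ED0.
have [qoo|qfin] := eqVneq (sqrte V + 4^-1%:E * S)%E +oo%E.
  rewrite qoo poweRyr ?invr_eq0// gt0_muley ?lte_fin// leey//.
have [Voo|[v v0 vE]] := (gee0P V).1 V0.
  by move: qfin; rewrite Voo /= addye ?eqxx// gt_eqF// (lt_le_trans (ltNyr 0))// mule_ge0// lee_fin.
have Sfin : S \is a fin_num.
  rewrite ge0_fin_numE// ltey; apply/negP => /eqP Soo.
  move: qfin; rewrite Soo vE gt0_muley ?lte_fin ?invr_gt0// addey ?eqxx//.
have iV : P.-integrable [set: Omega] (EFin \o (fun w => (Y w - 1) ^+ 2)).
  apply/integrableP; split.
    by apply/measurable_EFinP; apply: measurable_funX; exact: measurable_funB.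
  under eq_integral do rewrite /= ger0_norm ?sqr_ge0//.
  by rewrite -VE vE ltry.
have mD i : measurable_fun [set: Omega] (fun w => Delta f (X w) (X' w) i).
  have mp : measurable_fun [set: Omega] (fun w => (X w, X' w)).
    exact: measurable_fun_pair.
  apply: measurable_funB => //.
  exact: (measurableT_comp f_meas (measurableT_comp (measurable_swap _) mp)).
have iD3 i : P.-integrable [set: Omega]
    (EFin \o (fun w => `|Delta f (X w) (X' w) i| ^+ 3)).
  apply/integrableP; split.
    by apply/measurable_EFinP; apply: measurable_funX; exact: measurableT_comp.
  under eq_integral do rewrite /= ger0_norm ?exprn_ge0//.
  have : ('E_P[(fun w => `|Delta f (X w) (X' w) i| ^+ 3)%R])%E \is a fin_num.
    rewrite ge0_fin_numE// (le_lt_trans _ (_ : S < +oo)%E)//; last first.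
      by rewrite -ge0_fin_numE.
    by rewrite /S (bigD1 i)//= leeDl// sume_ge0.
  by rewrite ge0_fin_numE// unlock.
set q := stein_bound X X' f Y.
have q0 : 0 <= q by exact: stein_bound_ge0.
have qE : (sqrte V + 4^-1%:E * S = q%:E)%E.
  rewrite /q /stein_bound EFinD EFinM; congr (_ + _ * _)%E.
    by rewrite vE /=; congr (Num.sqrt _)%:E; rewrite /Rintegral -VE vE.
  rewrite -sumEFin; apply: eq_bigr => i _.
  by rewrite unlock /Rintegral fineK//; exact: integrable_fin_num (iD3 i).
rewrite qE poweR_EFin powR12_sqrt//.
apply: ge_ereal_sup => _ [t _ <-].
have PZE : (PZ [set w | (Z w <= t)%R] = (normal_cdf t)%:E)%E.
  have := Z_normal _ (measurable_itv `]-oo, t]).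
  rewrite /distribution /pushforward.
  have -> : Z @^-1` [set` `]-oo, t]] = [set w | Z w <= t].
    by apply/seteqP; split => w /=; rewrite in_itv.
  move=> ->; rewrite /normal_prob /normal_cdf /Rintegral fineK//.
  apply: integrable_fin_num => //.
  by apply: (@integrableS _ _ _ lebesgue_measure setT) => //; exact: integrable_normal_pdf.
rewrite PZE.
have mWt : measurable [set w | W w <= t].
  have -> : [set w | W w <= t] = W @^-1` `]-oo, t].
    by apply/seteqP; split => w /=; rewrite in_itv.
  by rewrite -[_ @^-1` _]setTI; apply: mW.
have Pfin : P [set w | W w <= t] \is a fin_num by exact: fin_num_measure.
rewrite -(fineK Pfin) -EFinB abse_EFin -EFinM lee_fin.
apply: smoothing_optimum => //; last first.
  move=> eps e0 e1.
  exact: (cdf_distance X_indep X'_copy f_meas n_gt0 iW2 EW0 Y_cond iV iD3 t e0 e1).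
have P0 : 0 <= fine (P [set w | W w <= t]) <= 1.
  by rewrite fine_ge0//= -lee_fin fineK// probability_le1.
have F0 : 0 <= normal_cdf t by apply: Rintegral_ge0 => x _; exact: normal_pdf_ge0.
have F1 : normal_cdf t <= 1.
  rewrite -lee_fin -PZE; apply: probability_le1.
  have -> : [set w | Z w <= t] = Z @^-1` `]-oo, t].
    by apply/seteqP; split => w /=; rewrite in_itv.
  exact: measurable_funPTI.
rewrite ler_norml; move/andP: P0 => [P0 P1]; apply/andP; split; lra.
Qed.
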